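(* Let $G$ be a connected graph of order $n$ and independence number $\alpha$, where $n \ge 2\alpha$ and $\alpha \ge 1$. Then $G$ has a spanning tree $T$ with $$\mu(T) < \begin{cases} \alpha+1 & \text{if } 1 \le \alpha \le 6,\\ \alpha + \frac12 + \frac{4(\alpha-1)}{\alpha^2} & \text{if } \alpha \ge 7.\end{cases}$$
   Context: For a connected graph $H$ on $n$ vertices, $d_H(u,v)$ denotes the distance between $u$ and $v$ in $H$, and the average distance is $\mu(H)=\binom{n}{2}^{-1}\sum_{\{u,v\}\subset V(H)} d_H(u,v)$. The independence number of a graph is the maximum cardinality of a set of pairwise non-adjacent vertices. *)

(* Defs.v *)
From mathcomp Require Export all_boot all_order all_algebra.

Set Implicit Arguments.
Unset Strict Implicit.
Unset Printing Implicit Defensive.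

Import Order.TTheory GRing.Theory Num.Theory.

Record sgraph (V : finType) := SGraph {
  adj :> rel V;
  adj_sym : symmetric adj;
  adj_irr : irreflexive adj
}.

Section Graphs.
Variable V : finType.
Implicit Types G H T : sgraph V.

Definition connected G : Prop := forall u v : V, connect G u v.

Definition acyclic G : Prop :=
  forall c : seq V, (2 < size c)%N -> ~ ucycle G c.

Definition is_tree T : Prop := connected T /\ acyclic T.

(* A spanning tree shares the vertex type, so only edges are compared. *)
Definition spanning_tree G T : Prop := subrel T G /\ is_tree T.

Definition uv_path_of_length G (u v : V) (k : nat) : bool :=
  [exists p : k.-tuple V, [&& path G u p, uniq (u :: p) & last u p == v]].

(* The least length (number of edges) of a u-v path; paths have fewer than   *)
(* #|V| edges.  The value is #|V| if u and v are not connected.              *)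
Definition dist G (u v : V) : nat :=
  find (uv_path_of_length G u v) (iota 0 #|V|).

(* The order on enum_rank selects each unordered pair {u, v} exactly once.   *)
Definition avg_dist G : rat :=
  (('C(#|V|, 2)%:R)^-1 *
   \sum_(u : V) \sum_(v : V | (enum_rank u < enum_rank v)%N) (dist G u v)%:R)%R.

Definition independent G (A : {set V}) : bool :=
  [forall u in A, forall v in A, ~~ G u v].

Definition indep_number G : nat :=
  \max_(A : {set V} | independent G A) #|A|.

Lemma dist_path G u v : connect G u v -> uv_path_of_length G u v (dist G u v).
Proof.
case/connectP=> p0 Gp0 def_v; rewrite /dist.
have: exists2 k, (k < #|V|)%N & uv_path_of_length G u v k.
  case/shortenP: Gp0 def_v => p Gp Up _ def_v; exists (size p).
    by have := max_card (mem (u :: p)); rewrite (card_uniqP Up).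
  by apply/existsP; exists (in_tuple p); rewrite Gp Up def_v eqxx.
case=> k ltk Pk.
have hasP : has (uv_path_of_length G u v) (iota 0 #|V|).
  by apply/hasP; exists k => //; rewrite mem_iota.
have := nth_find 0 hasP; rewrite nth_iota //.
by move: hasP; rewrite has_find size_iota.
Qed.

Lemma dist_min G u v k : uv_path_of_length G u v k -> (dist G u v <= k)%N.
Proof.
move=> Pk; rewrite leqNgt; apply/negP=> ltk.
have ltkV : (k < #|V|)%N.
  apply: leq_trans ltk _.
  by have := find_size (uv_path_of_length G u v) (iota 0 #|V|); rewrite size_iota.
by have := before_find 0 ltk; rewrite nth_iota // add0n Pk.
Qed.

End Graphs.

(* Main.v *)
Require Import Defs.
From mathcomp Require Import all_boot all_order all_algebra.
From mathcomp Require Import zify ring lra.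

(** If a tree has a connected core of [m] vertices to which the other vertices are
    attached as leaves, counting for every edge the pairs it separates bounds its
    total distance by [(m-1) n^2/4 + (n-m)(n-1)].

    Growing an independent set greedily, each new vertex at distance two from the
    old ones, gives a connected dominating set with at most [2 alpha - 1] vertices,
    hence average distance below [alpha + 1]; a core of [2 alpha - 2] vertices gives
    [alpha + 1/2].  Assume no such smaller core exists.  Starting the greedy process
    in a claw would save a vertex, so the graph is claw-free, and the core
    [D = A + connectors] is tree-like: each connector joins exactly two vertices of
    [A] and separates them.  Non-cut vertices of [D] have private neighbours, and the
    private neighbours of two non-cut vertices joined by an alternating path with
    non-adjacent consecutive connectors must be adjacent, since otherwise swapping
    along the path gives [alpha + 1] independent vertices.  Now either [D] has four
    non-cut vertices, which become four leaves of the core and save [n^2/4], or [D]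
    is covered by two alternating paths, one of which has at least [alpha] vertices
    and closes up to a cycle of length [N >= alpha + 2].  Averaged over the position
    of the removed edge, the edges of this cycle contribute only
    [n^2 (N^2-1)/(6N)] instead of about [n^2 N/4]. *)

Set Implicit Arguments.
Unset Strict Implicit.
Unset Printing Implicit Defensive.
Import Order.TTheory GRing.Theory Num.Theory.

(* [lia] case-splits on every boolean hypothesis, hence the clearing. *)
Ltac is_nat_fact b :=
  lazymatch b with
  | leq _ _ => idtac
  | odd _ => idtac
  | negb ?c => is_nat_fact c
  | andb ?c ?d => is_nat_fact c; is_nat_fact d
  | @eq_op _ ?x _ => let t := type of x in unify t nat
  end.

Ltac nat_lia :=
  repeat match goal with
  | H : is_true ?b |- _ => tryif is_nat_fact b then fail else clear H
  | H : @eq bool _ _ |- _ => clear H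
  end; lia.

(** * Trees given by a parent function *)

Lemma dist_leq_walk (V : finType) (T : sgraph V) u p :
  path T u p -> dist T u (last u p) <= size p.
Proof.
move=> pp; have [p' pp' up' sub_p] := shortenP pp.
apply: leq_trans (_ : size p' <= _).
  by apply: dist_min; apply/existsP; exists (in_tuple p'); rewrite pp' up' eqxx.
by apply: uniq_leq_size => //; case/andP: up'.
Qed.

Section ParentTree.
Variables (V : finType) (G : sgraph V) (r : V) (par : V -> V) (rk : V -> nat).
Hypothesis par_r : par r = r.
Hypothesis par_adj : forall x, x != r -> G (par x) x.
Hypothesis par_rk : forall x, x != r -> rk (par x) < rk x.

(** One side of the cut made by removing the edge from [x] to its parent; [x] itself belongs to
    it. *)
Definition descendants x : {set V} := [set v | fconnect par v x].

Lemma in_descendants_par v x :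
  (v \in descendants x) = (v == x) || (par v \in descendants x).
Proof. by rewrite !inE fconnect_eqVf. Qed.

Lemma descendants_root v : v \in descendants r.
Proof.
elim: {v}(rk v).+1 {-2}v (ltnSn (rk v)) => // k IHk v lev.
rewrite in_descendants_par; have [//|nr] := eqVneq v r.
by apply/IHk/(leq_trans (par_rk nr)).
Qed.

Lemma descendants_rk v x : v \in descendants x -> (v == x) || (rk x < rk v).
Proof.
elim: {v}(rk v).+1 {-2}v (ltnSn (rk v)) => // k IHk v lev.
rewrite in_descendants_par; have [//|vx /= dx] := eqVneq v x.
have nr : v != r.
  apply/eqP=> vr; move: dx; rewrite vr par_r inE => /iter_findex.
  by rewrite iter_fix // => rx; rewrite vr rx eqxx in vx.
have lt := par_rk nr; have := IHk _ (leq_trans lt lev) dx.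
by case/orP=> [/eqP<- //|/ltn_trans]; apply.
Qed.

Definition parent_rel : rel V :=
  [rel x y | (x != y) && ((par x == y) || (par y == x))].

Lemma parent_rel_sym : symmetric parent_rel.
Proof. by move=> x y; rewrite /parent_rel /= eq_sym orbC. Qed.

Lemma parent_rel_irr : irreflexive parent_rel.
Proof. by move=> x; rewrite /parent_rel /= eqxx. Qed.

Definition parent_tree := SGraph parent_rel_sym parent_rel_irr.

Lemma parent_treeE x y :
  parent_tree x y = (x != y) && ((par x == y) || (par y == x)).
Proof. by []. Qed.

Lemma parent_tree_par x : x != r -> parent_tree x (par x).
Proof.
move=> nr; rewrite parent_treeE eqxx andbT; apply/eqP=> e.
by have := par_rk nr; rewrite -e ltnn.
Qed.

Lemma parent_tree_sub : subrel parent_tree G.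
Proof.
have sub x y : x != y -> par x = y -> G y x.
  move=> xy e; have [xr|/par_adj] := eqVneq x r; last by rewrite e.
  by rewrite -e xr par_r eqxx in xy.
move=> x y; rewrite parent_treeE => /andP[xy /orP[]/eqP e]; first by rewrite adj_sym; apply: sub.
by apply: sub; rewrite 1?eq_sym.
Qed.

(** A non-root vertex stands for the edge to its parent, so these are the edges whose removal
    separates [u] from [v]. *)
Definition separators u v : {set V} :=
  [set x | (u \in descendants x) != (v \in descendants x)].

Lemma separatorsC u v : separators u v = separators v u.
Proof. by apply/setP=> x; rewrite !inE eq_sym. Qed.

(** A vertex of rank at most [rk u] and distinct from [u] does not descend from [u], so the edge
    above [u] separates the two; moving up to [par u] removes exactly this edge. *)
Lemma separators_par u v :
  u != v -> rk v <= rk u -> #|separators u v| = #|separators (par u) v|.+1.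
Proof.
move=> uv le.
have nr : u != r.
  apply/eqP=> ur; have := descendants_rk (descendants_root v).
  by rewrite -ur eq_sym (negbTE uv) ltnNge le.
have vu : v \in descendants u = false.
  by apply/negP=> /descendants_rk; rewrite eq_sym (negbTE uv) ltnNge le.
have pu : par u \in descendants u = false.
  have lt := par_rk nr; apply/negP=> /descendants_rk.
  by case/orP=> [/eqP e|]; [rewrite e in lt|]; nat_lia.
suff -> : separators u v = u |: separators (par u) v.
  by rewrite cardsU1 inE vu pu.
apply/setP=> x; rewrite in_setU1 [LHS]inE [in RHS]inE in_descendants_par (eq_sym u).
by have [->|//] := eqVneq x u; rewrite vu.
Qed.

Lemma parent_tree_walk u v :
  exists p, [/\ path parent_tree u p, last u p = v & size p = #|separators u v|].
Proof.
have [k] := ubnP (rk u + rk v); elim: k u v => // k IHk u v lek.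
have [->|uv] := eqVneq u v.
  exists [::]; split=> //; apply/esym/eqP; rewrite cards_eq0.
  by apply/eqP/setP=> x; rewrite !inE eqxx.
have nroot x y : x != y -> rk y <= rk x -> x != r.
  move=> xy le; apply/eqP=> xr; have := descendants_rk (descendants_root y).
  by rewrite -xr eq_sym (negbTE xy) ltnNge le.
have [le|/ltnW le] := leqP (rk v) (rk u).
  have nr := nroot _ _ uv le; have lt := par_rk nr.
  have [|p [pp lp sp]] := IHk (par u) v; first by nat_lia.
  exists (par u :: p); split=> //.
    by apply/andP; split; first exact: parent_tree_par.
  by rewrite /= sp -separators_par.
rewrite eq_sym in uv; have nr := nroot _ _ uv le; have lt := par_rk nr.
have [|p [pp lp sp]] := IHk u (par v); first by nat_lia.
exists (rcons p v); rewrite last_rcons size_rcons rcons_path pp lp; split=> //.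
  by rewrite adj_sym; apply: parent_tree_par.
by rewrite sp separatorsC -separators_par // separatorsC.
Qed.

Lemma parent_tree_connected : connected parent_tree.
Proof.
by move=> u v; have [p [pp <- _]] := parent_tree_walk u v; apply/connectP; exists p.
Qed.

(** A vertex of maximal rank on a cycle would have two distinct neighbours there, and both would
    have to be its parent. *)
Lemma parent_tree_acyclic : acyclic parent_tree.
Proof.
move=> c sz /andP[cyc uc].
have [x xc maxx] : exists2 x, x \in c & forall y, y \in c -> rk y <= rk x.
  case: c sz {cyc uc} => // x0 c _.
  have [x xc mx] := arg_maxnP rk (mem_head x0 c : [in x0 :: c] x0).
  by exists x.
have up y : y \in c -> parent_tree x y -> y = par x.
  move=> /maxx le; rewrite parent_treeE => /andP[xy /orP[/eqP //|/eqP e]].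
  have [yr|/par_rk] := eqVneq y r; last by rewrite e ltnNge le.
  by rewrite -e yr par_r eqxx in xy.
have [i c' ec] := rot_to xc.
have : cycle parent_tree (x :: c') by rewrite -ec rot_cycle.
have : uniq (x :: c') by rewrite -ec rot_uniq.
have sub : {subset c' <= c} by move=> y yc; rewrite -(mem_rot i) ec inE yc orbT.
move: sz; rewrite -(size_rot i) ec.
case: c' sub {ec} => [|y c'] // sub; case/lastP: c' sub => [|c' z] // sub _.
rewrite [cycle _ _]/= rcons_path last_rcons => /andP[_ uq] /and3P[xy _ zx].
have ey := up y (sub _ (mem_head _ _)) xy.
have ez : z = par x by apply: up; rewrite ?sub ?inE ?mem_rcons ?mem_head ?orbT // adj_sym.
by move: uq; rewrite /= mem_rcons ey ez mem_head.
Qed.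

Lemma parent_tree_spanning : spanning_tree G parent_tree.
Proof.
split; first exact: parent_tree_sub.
by split; [exact: parent_tree_connected | exact: parent_tree_acyclic].
Qed.

Lemma card_separating_pairs x :
  \sum_(u : V) \sum_(v : V) ((u \in descendants x) != (v \in descendants x) : nat)
    = 2 * (#|descendants x| * (#|V| - #|descendants x|)).
Proof.
have cardC' : #|V| - #|descendants x| = #|~: descendants x|.
  by rewrite -(cardsC (descendants x)) addKn.
have sum_in (b : bool) : \sum_(v : V) (b != (v \in descendants x) : nat) =
    if b then #|V| - #|descendants x| else #|descendants x|.
  case: b.
    rewrite cardC' -sum1_card [RHS]big_mkcond; apply: eq_bigr => v _.
    by rewrite in_setC; case: (_ \in _).
  by rewrite -sum1_card [RHS]big_mkcond; apply: eq_bigr => v _; case: (_ \in _).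
under eq_bigr => u _ do rewrite sum_in.
rewrite (bigID (mem (descendants x))) /=.
under eq_bigr => u -> do [].
rewrite sum_nat_const.
under eq_bigr => u /negbTE -> do [].
rewrite sum_nat_const; have -> : #|[pred u | u \notin descendants x]| = #|V| - #|descendants x|.
  by rewrite cardC'; apply: eq_card => u; rewrite !inE.
by rewrite mul2n -addnn; congr (_ + _); rewrite mulnC.
Qed.

Lemma parent_tree_wiener :
  \sum_(u : V) \sum_(v : V | enum_rank u < enum_rank v) dist parent_tree u v
    <= \sum_(x | x != r) #|descendants x| * (#|V| - #|descendants x|).
Proof.
pose d u v := #|separators u v|.
have le_d u v : dist parent_tree u v <= d u v.
  have [p [pp e sp]] := parent_tree_walk u v.
  by rewrite /d -sp -e; apply: dist_leq_walk.
apply: (@leq_trans (\sum_u \sum_(v | enum_rank u < enum_rank v) d u v)).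
  by apply: leq_sum => u _; apply: leq_sum => v _; apply: le_d.
(* Doubling passes to ordered pairs, for which the choice of order by [enum_rank] disappears; the
   root adds a zero term. *)
rewrite -(leq_pmul2l (isT : 0 < 2)) mul2n -addnn.
have -> : \sum_(x | x != r) #|descendants x| * (#|V| - #|descendants x|) =
          \sum_x #|descendants x| * (#|V| - #|descendants x|).
  rewrite [in RHS](bigD1 r) //=.
  have -> : descendants r = setT by apply/setP=> v; rewrite descendants_root inE.
  by rewrite cardsT subnn muln0.
rewrite big_distrr /=; under [in X in _ <= X]eq_bigr => x _ do rewrite -card_separating_pairs.
have -> : \sum_x \sum_u \sum_v ((u \in descendants x) != (v \in descendants x) : nat)
   = \sum_u \sum_v d u v.
  rewrite exchange_big; apply: eq_bigr => u _; rewrite exchange_big.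
  apply: eq_bigr => v _; rewrite /d -sum1_card [RHS]big_mkcond.
  by apply: eq_bigr => x _; rewrite [x \in _]inE; case: (_ != _).
under [in X in _ <= X]eq_bigr => u _ do rewrite (bigID (fun v => enum_rank u < enum_rank v)) /=.
rewrite big_split /= leq_add2l.
rewrite (exchange_big_dep xpredT) //=; apply: leq_sum => u _.
rewrite [leqLHS]big_mkcond [leqRHS]big_mkcond; apply: leq_sum => v _.
by case: ltngtP => //= _; rewrite /d separatorsC.
Qed.
End ParentTree.

(** * Connected and dominating sets *)

Section ConnectedSets.
Variables (V : finType) (G : sgraph V).
Implicit Types S D B : {set V}.

Definition induced S : rel V := [rel x y | [&& x \in S, y \in S & G x y]].

Definition set_connected S : bool :=
  [forall x in S, forall y in S, connect (induced S) x y].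

Definition dominating S : bool :=
  [forall x, (x \in S) || [exists y in S, G y x]].

Lemma inducedE S x y : induced S x y = [&& x \in S, y \in S & G x y].
Proof. by []. Qed.

Lemma set_connectedP S :
  reflect {in S &, forall x y, connect (induced S) x y} (set_connected S).
Proof.
apply: (iffP forall_inP) => [h x y xS yS|h x xS]; last by apply/forall_inP => y; apply: h.
by move/forall_inP: (h x xS); apply.
Qed.

Lemma dominatingP S :
  reflect (forall x, x \notin S -> exists2 y, y \in S & G y x) (dominating S).
Proof.
apply: (iffP forallP) => h x; first by move=> xS; have:= h x; rewrite (negbTE xS) => /exists_inP.
by have [//|/h H] := boolP (x \in S); apply/exists_inP.
Qed.

Lemma induced_sym S : symmetric (induced S).
Proof. by move=> x y; rewrite !inducedE adj_sym andbCA. Qed.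

Lemma connect_induced_sym S : connect_sym (induced S).
Proof. exact: sym_connect_sym (induced_sym S). Qed.

Lemma connect_induced_mono S S' x y :
  S \subset S' -> connect (induced S) x y -> connect (induced S') x y.
Proof.
move=> /subsetP sub; apply: connect_sub => a b /and3P[aS bS ab].
by apply: connect1; rewrite inducedE !sub.
Qed.

Lemma set_connected_hub S p :
  {in S, forall x, connect (induced S) x p} -> set_connected S.
Proof.
move=> hub; apply/set_connectedP=> x y xS yS.
by apply: connect_trans (hub x xS) _; rewrite connect_induced_sym hub.
Qed.

Lemma set_connectedU1 S x y :
  set_connected S -> y \in S -> G y x -> set_connected (x |: S).
Proof.
move=> /set_connectedP cS yS yx; apply: (@set_connected_hub _ y) => z.
rewrite in_setU1 => /orP[/eqP->|zS].
  by apply: connect1; rewrite inducedE setU11 setU1r // adj_sym.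
by apply: connect_induced_mono (subsetUr _ _) (cS _ _ zS yS).
Qed.

Lemma set_connected1 x : set_connected [set x].
Proof. by apply/set_connectedP=> a b /set1P-> /set1P->. Qed.

Lemma set_connectedT : connected G -> set_connected setT.
Proof.
move=> cG; apply/set_connectedP=> x y _ _.
by apply: connect_sub (cG x y) => a b ab; apply: connect1; rewrite inducedE !inE.
Qed.

Lemma set_connected_boundary S S' :
  set_connected S' -> S \proper S' -> S != set0 ->
  exists x y, [/\ x \in S', x \notin S, y \in S & G y x].
Proof.
move=> /set_connectedP cS' /properP[sub [t tS' tS]] /set0Pn[s sS].
have [/existsP[x /existsP[y /and4P[? ? ? ?]]]|none] :=
  boolP [exists x, [exists y, [&& x \in S', x \notin S, y \in S & G y x]]].
  by exists x, y.
case/negP: tS; have cl : closed (induced S') (mem S).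
  apply: intro_closed; first exact: connect_induced_sym.
  move=> x y /and3P[_ yS' xy] xS; apply: contraR none => yS.
  by apply/existsP; exists y; apply/existsP; exists x; apply/and4P.
by rewrite -(closed_connect cl (cS' s t (subsetP sub s sS) tS')).
Qed.

(** A walk to [p] is followed until it is about to enter [w]; the vertex reached is then a neighbour
    of [w], and the hypothesis leads from it to [p]. *)
Lemma set_connectedD1 S w p :
  set_connected S -> p \in S :\ w ->
  (forall x, x \in S :\ w -> G w x -> connect (induced (S :\ w)) x p) ->
  set_connected (S :\ w).
Proof.
move=> /set_connectedP cS pS hub; apply: (@set_connected_hub _ p) => x xS.
have/setD1P[_ pS'] := pS; have/setD1P[_ xS'] := xS.
have /connectP[l pl lp] := cS x p xS' pS'.
elim: l x xS xS' pl lp => [|y l IHl] x xS xS' /=; first by move=> _ ->.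
case/andP=> /and3P[_ yS' xy] pl lp; have [yw|yw] := eqVneq y w.
  by apply: hub => //; rewrite adj_sym -yw.
have yS : y \in S :\ w by rewrite in_setD1 yw.
by apply: connect_trans (connect1 _) (IHl y yS yS' pl lp); rewrite inducedE xS yS.
Qed.

Lemma set_connectedD1_clique S w :
  set_connected S -> w \in S -> 1 < #|S| ->
  {in S &, forall x y, G w x -> G w y -> x != y -> G x y} ->
  set_connected (S :\ w).
Proof.
move=> cS wS S1 cl.
have [||x [p [xS xS1 /set1P pE wx]]] := set_connected_boundary (S := [set w]) cS.
- by rewrite properEcard sub1set wS cards1.
- by apply/set0Pn; exists w; rewrite set11.
rewrite pE in wx; rewrite in_set1 in xS1.
have xS' : x \in S :\ w by rewrite in_setD1 xS1.
apply: (set_connectedD1 cS xS') => y yS' wy.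
have [->//|yx] := eqVneq y x; have/setD1P[_ yS] := yS'.
by apply: connect1; rewrite inducedE yS' xS' cl.
Qed.

(** [S1] is grown inside [S] by one boundary vertex at a time; the last vertex added can be deleted
    again. *)
Lemma noncut_vertex_outside S1 S :
  set_connected S -> set_connected S1 -> S1 != set0 -> S1 \proper S ->
  exists2 w, w \in S :\: S1 & set_connected (S :\ w).
Proof.
move=> cS; have [k] := ubnP (#|S| - #|S1|); elim: k S1 => // k IHk S1 lek cS1 ne pr.
have [x [y [xS xS1 yS1 yx]]] := set_connected_boundary cS pr ne.
have sub : x |: S1 \subset S by rewrite subUset sub1set xS proper_sub.
have [eq|neq] := eqVneq (x |: S1) S.
  exists x; first by rewrite inE xS1.
  by rewrite -eq setU1K.
have := proper_card pr; have cU := cardsU1 x S1; rewrite xS1 in cU => lt.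
have [||||w] := IHk (x |: S1).
- by nat_lia.
- exact: set_connectedU1 cS1 yS1 yx.
- by apply/set0Pn; exists x; rewrite setU11.
- by rewrite properEneq neq.
by rewrite !inE negb_or -andbA => /and3P[_ w1 wS] cw; exists w; rewrite // inE w1.
Qed.

(** A forest on [S] with root set [B]; the decreasing rank certifies acyclicity, and parents of
    roots are left free. *)
Definition forest B S (par : V -> V) (rk : V -> nat) : Prop :=
  forall x, x \in S -> x \notin B -> [/\ par x \in S, G (par x) x & rk (par x) < rk x].

Lemma forest_attach B S S' par rk :
  forest B S par rk ->
  (forall x, x \in S' -> x \notin S -> exists2 y, y \in S & G y x) ->
  exists par' rk', [/\ forest B (S :|: S') par' rk', {in S, par' =1 par}
     & forall x, x \in S' -> x \notin S -> par' x \in S].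
Proof.
move=> fS att.
pose par' x := if x \in S then par x else odflt x [pick y in S | G y x].
(* All new vertices share one rank above every old one: they form a single layer hung on [S]. *)
pose rk' x := if x \in S then rk x else (\max_y rk y).+1.
have par'P x : x \in S' -> x \notin S -> (par' x \in S) && G (par' x) x.
  move=> xS' xS; rewrite /par' (negbTE xS); case: pickP => [//|none].
  by have [y yS yx] := att x xS' xS; have := none y; rewrite yS yx.
exists par', rk'; split=> [x xU xB|x xS|x xS' xS].
- rewrite inE; have [xS|xS] := boolP (x \in S).
    have [pS px rx] := fS x xS xB.
    by rewrite /rk' {1 2 3}/par' xS pS /par' xS pS.
  have xS' : x \in S' by move: xU; rewrite inE (negbTE xS).
  have/andP[pS px] := par'P x xS' xS.
  by rewrite /rk' pS (negbTE xS) ltnS leq_bigmax.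
- by rewrite /par' xS.
- by case/andP: (par'P x xS' xS).
Qed.

Lemma forest_grow B D :
  set_connected D -> B \subset D -> B != set0 -> exists par rk, forest B D par rk.
Proof.
move=> cD sBD neB.
suff: forall k S, #|D| - #|S| < k -> B \subset S -> S \subset D ->
    (exists par rk, forest B S par rk) -> exists par rk, forest B D par rk.
  move=> /(_ _ B (ltnSn _) (subxx _) sBD); apply.
  by exists id, (fun=> 0) => x xB /negP.
elim=> // k IHk S lek sBS sSD [par [rk fS]].
have [eq|neq] := eqVneq S D; first by exists par, rk; rewrite -eq.
have pr : S \proper D by rewrite properEneq neq.
have neS : S != set0.
  by case/set0Pn: neB => b bB; apply/set0Pn; exists b; apply: (subsetP sBS).
have [x [y [xD xS yS yx]]] := set_connected_boundary cD pr neS.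
have [|par' [rk' [f' _ _]]] := @forest_attach B S [set x] par rk fS.
  by move=> _ /set1P-> _; exists y.
apply: (IHk (S :|: [set x])); last by exists par', rk'.
- have := proper_card pr; rewrite setUC cardsU1 xS; nat_lia.
- exact: subset_trans sBS (subsetUl _ _).
- by rewrite subUset sSD sub1set.
Qed.
End ConnectedSets.

(** * Spanning trees with a small core *)

Definition wiener (V : finType) (T : sgraph V) : nat :=
  \sum_(u : V) \sum_(v : V | enum_rank u < enum_rank v) dist T u v.

Lemma avg_dist_lt (V : finType) (T : sgraph V) (q : rat) :
  1 < #|V| ->
  ((2 * wiener T)%:R < q * #|V|%:R * (#|V|%:R - 1) :> rat)%R -> (avg_dist T < q)%R.
Proof.
move=> n1 lt; rewrite /avg_dist.
have -> : (\sum_(u : V) \sum_(v : V | (enum_rank u < enum_rank v)%N) (dist T u v)%:R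
           = (wiener T)%:R :> rat)%R.
  rewrite /wiener GRing.natr_sum; apply: eq_bigr => u _.
  by rewrite GRing.natr_sum.
have e : (2 * 'C(#|V|, 2) = #|V| * (#|V| - 1))%N.
  by rewrite -mul_bin_diag bin1 subn1.
have e2 : ((2 * 'C(#|V|, 2)%:R)%R = #|V|%:R * (#|V|%:R - 1) :> rat)%R.
  rewrite -(GRing.natrM _ 2) e GRing.natrM GRing.natrB //; nat_lia.
have C0 : (0 < 'C(#|V|, 2)%:R :> rat)%R by rewrite Num.Theory.ltr0n bin_gt0.
rewrite mulrC Num.Theory.ltr_pdivrMr //.
move: lt; rewrite GRing.natrM -mulrA -e2; lra.
Qed.

Lemma sum_cauchy (I : finType) (P : pred I) (f : I -> nat) :
  (\sum_(i | P i) f i) ^ 2 <= #|P| * \sum_(i | P i) f i ^ 2.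
Proof.
rewrite -(leq_pmul2l (isT : 0 < 2)).
have -> : 2 * (\sum_(i | P i) f i) ^ 2 =
    \sum_(i | P i) \sum_(j | P j) 2 * (f i * f j).
  rewrite -mulnn big_distrl big_distrr /=; apply: eq_bigr => i _.
  by rewrite big_distrr big_distrr.
have -> : 2 * (#|P| * \sum_(i | P i) f i ^ 2) =
    \sum_(i | P i) \sum_(j | P j) (f i ^ 2 + f j ^ 2).
  under [RHS]eq_bigr => i _ do rewrite big_split /= sum_nat_const.
  rewrite big_split /= sum_nat_const -big_distrr /=; nat_lia.
by apply: leq_sum => i _; apply: leq_sum => j _; apply: nat_Cauchy.
Qed.

Lemma sum_mul_compl (I : finType) (P : pred I) (f : I -> nat) n :
  (forall i, f i <= n) ->
  \sum_(i | P i) f i * (n - f i) + \sum_(i | P i) f i ^ 2 = n * \sum_(i | P i) f i.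
Proof.
move=> le; rewrite -big_split big_distrr; apply: eq_bigr => i _ /=.
by have := le i; nia.
Qed.

Lemma four_mul_compl_le s n : 4 * (s * (n - s)) <= n ^ 2.
Proof.
have [le|lt] := leqP s n; last by rewrite (eqP (ltnW lt : n - s == 0)) muln0.
by have [+ _] := nat_AGM2 s (n - s); rewrite subnKC.
Qed.

Section SpanningTrees.
Variables (V : finType) (G : sgraph V).
Implicit Types S D B E : {set V}.
Let n := #|V|.

Lemma descendants_closed (par : V -> V) D v x :
  (forall y, y \in D -> par y \in D) -> v \in D -> v \in descendants par x -> x \in D.
Proof.
move=> cl vD; rewrite inE => /iter_findex <-.
by elim: (findex _ _ _) => //= k; apply: cl.
Qed.

Lemma descendants_pendant (par : V -> V) D x :
  (forall y, par y \in D) -> x \notin D -> descendants par x = [set x].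
Proof.
move=> cl xD; apply/setP=> v; rewrite in_descendants_par in_set1.
have [//|_] := eqVneq v x; apply: contraNF xD.
by apply: descendants_closed.
Qed.
Lemma spanning_tree_of_forest r par rk :
  forest G [set r] setT par rk -> par r = r ->
  exists2 T, spanning_tree G T &
    wiener T <= \sum_(x | x != r) #|descendants par x| * (n - #|descendants par x|).
Proof.
move=> f pr.
have H x : x != r -> G (par x) x /\ rk (par x) < rk x.
  by move=> xr; case: (f x) => //; rewrite ?inE.
have Hadj x (xr : x != r) := (H x xr).1; have Hrk x (xr : x != r) := (H x xr).2.
exists (parent_tree par); first exact: parent_tree_spanning pr Hadj Hrk.
exact: parent_tree_wiener pr Hrk.
Qed.

Lemma forest_reroot r par rk D :
  forest G [set r] setT par rk -> r \in D -> (forall x, x != r -> par x \in D) ->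
  exists par', [/\ forest G [set r] setT par' rk, par' r = r,
     forall x, par' x \in D & forall x, x != r -> par' x = par x].
Proof.
move=> f rD pD; exists (fun x => if x == r then r else par x); split.
- by move=> x _ xr; have [//|_ ? ?] := f x _ xr; rewrite in_set1 in xr; rewrite (negbTE xr).
- by rewrite eqxx.
- by move=> x; case: eqVneq => // /pD.
- by move=> x /negbTE->.
Qed.

(** A vertex outside [D] is nobody's parent, so its edge cuts off one vertex and contributes
    [n - 1]. *)
Lemma wiener_split r par D :
  r \in D -> (forall x, par x \in D) ->
  4 * \sum_(x | x != r) #|descendants par x| * (n - #|descendants par x|) =
  \sum_(x in D :\ r) 4 * (#|descendants par x| * (n - #|descendants par x|))
    + 4 * (n - #|D|) * (n - 1).
Proof.
move=> rD cl; rewrite (bigID (mem D)) /= mulnDr; congr (_ + _).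
  by rewrite big_distrr; apply: eq_bigl => x; rewrite in_setD1.
rewrite -mulnA; congr (_ * _).
transitivity (\sum_(x in ~: D) (n - 1)).
  apply: eq_big => [x|x /andP[_ xD]].
    by rewrite inE; have [->|//] := eqVneq x r; rewrite rD.
  by rewrite (descendants_pendant cl) // cards1 mul1n.
by rewrite sum_nat_const; congr (_ * _); rewrite /n -(cardsC D) addKn.
Qed.

Lemma core_spanning_tree D :
  set_connected G D -> dominating G D -> D != set0 ->
  exists2 T, spanning_tree G T &
    4 * wiener T <= (#|D| - 1) * n ^ 2 + 4 * (n - #|D|) * (n - 1).
Proof.
move=> cD /dominatingP dD /set0Pn[r rD].
have [||par0 [rk0 f0]] := @forest_grow V G [set r] D cD.
- by rewrite sub1set.
- by apply/set0Pn; exists r; rewrite set11.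
have [|par1 [rk [f1 ag pd]]] := @forest_attach V G [set r] D setT par0 rk0 f0.
  by move=> x _; apply: dD.
rewrite setUT in f1.
have pD x : x != r -> par1 x \in D.
  move=> xr; have [xD|/pd->//] := boolP (x \in D); rewrite ag //.
  by have [] := f0 x xD; rewrite ?in_set1.
have [par [f pr clD _]] := forest_reroot f1 rD pD.
have [T sT leW] := spanning_tree_of_forest f pr; exists T => //.
apply: leq_trans (leq_mul (leqnn 4) leW) _.
rewrite (wiener_split rD clD) leq_add2r.
have -> : #|D| - 1 = #|D :\ r| by rewrite (cardsD1 r D) rD addKn.
by rewrite -sum_nat_const; apply: leq_sum => x _; apply: four_mul_compl_le.
Qed.

(** The branches at the four vertices of [E] are disjoint, so their sizes sum to some [c <= n]. By
    Cauchy-Schwarz their edges contribute at most [n c - c^2/4 <= 3 n^2/4], instead of [n^2/4]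
    each. *)
Lemma four_leaves_spanning_tree S E :
  set_connected G S -> S != set0 -> #|E| = 4 -> [disjoint S & E] ->
  (forall x, x \in E -> exists2 y, y \in S & G y x) -> dominating G (S :|: E) ->
  exists2 T, spanning_tree G T &
    4 * wiener T <= (#|S| + 2) * n ^ 2 + 4 * (n - (#|S| + 4)) * (n - 1).
Proof.
move=> cS /set0Pn[r rS] cardE disj attE /dominatingP dD.
have [||par0 [rk0 f0]] := @forest_grow V G [set r] S cS.
- by rewrite sub1set.
- by apply/set0Pn; exists r; rewrite set11.
have [|par1 [rk1 [f1 ag1 pd1]]] := @forest_attach V G [set r] S E par0 rk0 f0.
  by move=> x xE _; apply: attE.
(* Building in the layers [S], [E], rest puts the parents of [E] into [S] and all other parents into
   [D]. *)
have [|par2 [rk [f2 ag2 pd2]]] := @forest_attach V G [set r] _ setT par1 rk1 f1.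
  by move=> x _; apply: dD.
rewrite setUT in f2; set D := S :|: E in f1 ag2 pd2 dD *.
have rD : r \in D by rewrite inE rS.
have SD : {subset S <= D} by move=> x xS; rewrite inE xS.
have parS x : x \in S -> x != r -> par2 x \in S.
  move=> xS xr; rewrite ag2 ?SD // ag1 //.
  by have [] := f0 x xS; rewrite ?in_set1.
have ES x : x \in E -> x \notin S by move=> xE; rewrite (disjointFl disj).
have parE x : x \in E -> par2 x \in S.
  by move=> xE; rewrite ag2 ?inE ?xE ?orbT // pd1 ?ES.
have pD x : x != r -> par2 x \in D.
  move=> xr; have [/setUP[xS|xE]|/pd2->//] := boolP (x \in D).
    exact/SD/parS.
  exact/SD/parE.
have [par [f pr clD ag3]] := forest_reroot f2 rD pD.
have clS x : x \in S -> par x \in S.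
  by move=> xS; have [->|xr] := eqVneq x r; rewrite ?pr // ag3 ?parS.
have clE x : x \in E -> par x \in S.
  by move=> xE; rewrite ag3 ?parE //; apply: contraTneq xE => ->; rewrite (disjointFr disj).
have [T sT leW] := spanning_tree_of_forest f pr; exists T => //.
apply: leq_trans (leq_mul (leqnn 4) leW) _.
have cardD : #|D| = #|S| + 4 by rewrite -cardE /D cardsU (disjoint_setI0 disj) cards0 subn0.
rewrite (wiener_split rD clD) cardD leq_add2r.
pose s x := #|descendants par x|.
have sumS : \sum_(x in E) s x <= n.
  have -> : \sum_(x in E) s x = \sum_v #|[set x in E | v \in descendants par x]|.
    rewrite /s; under eq_bigr => x _ do rewrite -sum1_card big_mkcond.
    rewrite exchange_big; apply: eq_bigr => v _.
    rewrite -sum1_card -big_mkcondr; apply: eq_bigl => x; by rewrite inE.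
  apply: (@leq_trans (\sum_(v : V) 1)); last by rewrite sum1_card.
  have SnE v x : v \in S -> x \in E -> v \in descendants par x = false.
    move=> vS xE; apply: contraNF (ES x xE); exact: descendants_closed.
  have one v : v \in D -> #|[set x in E | v \in descendants par x]| <= 1.
    case/setUP=> [vS|vE].
      by rewrite eq_card0 // => x; rewrite inE; apply/andP=> -[xE]; rewrite SnE.
    rewrite -(cards1 v) subset_leq_card //; apply/subsetP=> x.
    rewrite inE in_set1 => /andP[xE]; rewrite in_descendants_par SnE ?clE // orbF.
    by rewrite eq_sym.
  apply: leq_sum => v _; have [/one//|vD] := boolP (v \in D).
  apply: leq_trans (one _ (clD v)); apply/subset_leq_card/subsetP=> x.
  rewrite !inE -!/(_ \in descendants par _) => /andP[xE].
  rewrite xE fconnect_eqVf; case: eqVneq => //= vx.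
  by rewrite vx inE xE orbT in vD.
have sumE : \sum_(x in E) 4 * (s x * (n - s x)) <= 3 * n ^ 2.
  have arith a b c : a + b = n * c -> c <= n -> c ^ 2 <= 4 * b -> 4 * a <= 3 * n ^ 2.
    move=> e /subnKC; rewrite -!mulnn; set d := n - c => en C.
    by rewrite -en in e *; nia.
  rewrite -big_distrr /=; apply: arith (sum_mul_compl _ (fun x => max_card _)) sumS _.
  by rewrite -[4]cardE; apply: sum_cauchy.
have -> : \sum_(x in D :\ r) 4 * (s x * (n - s x)) =
   \sum_(x in S :\ r) 4 * (s x * (n - s x)) + \sum_(x in E) 4 * (s x * (n - s x)).
  rewrite -bigU /=; last exact: disjointWl (subsetDl _ _) disj.
  apply: eq_bigl => x; rewrite !inE; have [->|//] := eqVneq x r.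
  by rewrite (disjointFr disj rS).
have sumC : \sum_(x in S :\ r) 4 * (s x * (n - s x)) <= (#|S| - 1) * n ^ 2.
  have -> : #|S| - 1 = #|S :\ r| by rewrite (cardsD1 r S) rS addKn.
  by rewrite -sum_nat_const; apply: leq_sum => x _; apply: four_mul_compl_le.
have S1 : 0 < #|S| by apply/card_gt0P; exists r.
apply: leq_trans (leq_add sumC sumE) _; nia.
Qed.
End SpanningTrees.

(** * Spanning trees with a cyclic core *)

Lemma Zp_val_subr1 m (i : 'I_m.+2) : i != 0%R -> val (i - 1)%R = (val i).-1.
Proof.
move=> i0; have : 0 < val i by rewrite lt0n; apply: contraNneq i0 => e; apply/eqP/val_inj.
case: i {i0} => i lti /= i0.
rewrite [1 %% _]modn_small // subn1 /= [m.+1 %% _]modn_small //.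
by rewrite -{1}(prednK i0) addSnnS modnDr modn_small //; nat_lia.
Qed.

Lemma six_sum_mul_compl N : 6 * \sum_(i < N) i * (N - i) = N ^ 3 - N.
Proof.
have s1 k : 2 * \sum_(i < k) i = k * k.-1.
  by elim: k => [|k IHk]; rewrite ?big_ord0 // big_ord_recr /= mulnDr IHk; nia.
have s2 k : 6 * \sum_(i < k) i ^ 2 = k.-1 * k * (2 * k.-1 + 1).
  by elim: k => [|k IHk]; rewrite ?big_ord0 // big_ord_recr /= mulnDr IHk; nia.
have e : \sum_(i < N) i * (N - i) + \sum_(i < N) i ^ 2 = N * \sum_(i < N) i.
  by apply: sum_mul_compl => i; apply: ltnW.
have := s1 N; have := s2 N; case: N e => [|N] e; first by rewrite !big_ord0.
move: e; set a := \sum_(i < N.+1) _ * _; set b := \sum_(i < N.+1) _ ^ 2.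
set c := \sum_(i < N.+1) _ => /=; nia.
Qed.

(** [pr v] is the root above [v]. Since the rank drops at each step outside [B] and roots stay
    fixed, [rk v] steps upwards suffice. *)
Lemma forest_projection (V : finType) (G : sgraph V) (B : {set V}) par rk :
  forest G B setT par rk ->
  exists pr : V -> V, [/\ forall v, pr v \in B, {in B, pr =1 id}
    & forall v, v \notin B -> pr v = pr (par v)].
Proof.
move=> f; pose g x := if x \in B then x else par x.
have gB k v : v \in B -> iter k g v = v by move=> vB; apply: iter_fix; rewrite /g vB.
have prB k v : rk v <= k -> iter k g v \in B.
  elim: k v => [|k IHk] v lek; have [vB|vB] := boolP (v \in B).
  - by [].
  - by have [_ _] := f v (in_setT v) vB; nat_lia.
  - by rewrite gB.
  rewrite iterSr {2}/g (negbTE vB); apply: IHk.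
  by have [_ _] := f v (in_setT v) vB; nat_lia.
exists (fun v => iter (rk v) g v); split=> [v|v vB|v vB]; [exact: prB|exact: gB|].
have [_ _ lt] := f v (in_setT v) vB; rewrite -(prednK (leq_ltn_trans (leq0n _) lt)).
rewrite iterSr {2}/g (negbTE vB) -(subnK (_ : rk (par v) <= (rk v).-1)); last by nat_lia.
by rewrite iterD gB ?prB.
Qed.

Section CutSizes.
Variables (V : finType) (m : nat) (p : V -> 'I_m.+2).
Let n := #|V|.
Let N := m.+2.

(** With [p] the position on the cycle below which a vertex hangs, and the cycle cut open just
    before [k], this counts the vertices at or beyond the [i]-th place after [k]. *)
Definition cut_size (k i : 'I_N) := #|[set v | val i <= val (p v - k)%R]|.

(** For a fixed vertex, the difference [p v - k] takes every residue once as [k] varies, and [N - i]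
    of these are at least [i]. *)
Lemma sum_cut_size i : \sum_k cut_size k i = n * (N - i).
Proof.
rewrite /cut_size; under eq_bigr => k _ do rewrite -sum1_card big_mkcond.
rewrite exchange_big -sum_nat_const; apply: eq_bigr => v _.
rewrite (reindex_inj (addrI (p v))) (reindex_inj (@oppr_inj _)).
under eq_bigr => k _ do rewrite in_set opprD opprK addrA subrr add0r.
rewrite -big_mkcond sum1_card.
have lt_i : #|[pred k : 'I_N | k < i]| = i.
  by rewrite -sum1_card (big_ord_narrow (ltnW (ltn_ord i))) sum1_card card_ord.
have := cardC [pred k : 'I_N | k < i]; rewrite lt_i card_ord => e.
transitivity #|[predC [pred k : 'I_N | k < i]]|; last first.
  by apply/eqP; rewrite -(eqn_add2l i) e subnKC // ltnW.
by apply: eq_card => k; rewrite !inE -leqNgt.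
Qed.

(* Averaging over all positions [k] of the removed edge: for fixed [i] the arcs
   [cut_size k i] have a sum independent of the weights, so Cauchy-Schwarz bounds
   their contribution by that of the uniform weight. *)
Lemma exists_good_cut :
  exists k, 6 * N * \sum_i cut_size k i * (n - cut_size k i) <= n ^ 2 * (N ^ 2 - 1).
Proof.
pose X k := \sum_i cut_size k i * (n - cut_size k i).
have col i : N * \sum_k cut_size k i * (n - cut_size k i) <= n ^ 2 * (i * (N - i)).
  have le k : cut_size k i <= n by apply: max_card.
  have e := @sum_mul_compl _ xpredT (fun k => cut_size k i) n le.
  have := @sum_cauchy _ xpredT (fun k => cut_size k i).
  rewrite sum_cut_size in e *; rewrite card_ord.
  move: e; set a := \sum_(k | _) _ * _; set b := \sum_(k | _) _ => e C.
  have := subnKC (ltnW (ltn_ord i)); move: (val i) C e => c C e; move: (N - c) C e => j C e cj.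
  rewrite -(leq_add2r (N * b)) -mulnDr e; apply: leq_trans (leq_add (leqnn _) C).
  by rewrite -{1}cj expnMn -!mulnn; apply/eq_leq; ring.
have tot : 6 * N * \sum_k X k <= n ^ 2 * (N ^ 3 - N).
  rewrite exchange_big /= -six_sum_mul_compl -mulnA [leqRHS]mulnCA leq_mul2l /=.
  rewrite !big_distrr /=; apply: leq_sum => i _; exact: col.
have [k _ min] := arg_minnP X (isT : xpredT (0%R : 'I_N)); exists k.
have : \sum_(k' : 'I_N) X k <= \sum_k' X k' by apply: leq_sum => k' _; apply: min.
rewrite sum_nat_const card_ord -/(X k) => le.
have N0 : 0 < N by [].
rewrite -(leq_pmul2l N0); apply: leq_trans (leq_trans _ tot) _; last by nia.
by rewrite mulnCA leq_mul2l le orbT.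
Qed.
End CutSizes.

Section Cycle.
Variables (V : finType) (G : sgraph V) (m : nat) (y : 'I_m.+2 -> V).
Let n := #|V|.
Let N := m.+2.
Hypothesis y_inj : injective y.
Hypothesis y_adj : forall i, G (y i) (y (i + 1)%R).
Variables (D : {set V}) (par : V -> V) (rk : V -> nat).
Let Y : {set V} := [set y i | i : 'I_N].
Hypothesis YD : Y \subset D.
Hypothesis Dforest : forest G Y setT par rk.
Hypothesis parD : forall x, x \notin Y -> par x \in D.
Variable p : V -> 'I_N.
Hypothesis p_y : forall i, p (y i) = i.
Hypothesis p_par : forall v, v \notin Y -> p v = p (par v).

Lemma cycle_mem i : y i \in Y.
Proof. exact: imset_f. Qed.

Lemma cycle_memP v : v \in Y -> v = y (p v).
Proof. by case/imsetP=> i _ ->; rewrite p_y. Qed.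

Section Cut.
Variable k : 'I_N.

(** The cycle becomes a path starting at its root [y k], losing the edge from [y (k - 1)] to [y k];
    off the cycle the forest is kept. *)
Definition cut_par v :=
  if v \in Y then (if p v == k then v else y (p v - 1)%R) else par v.
(** The shift by [N] places all other vertices above the cycle. *)
Definition cut_rk v := if v \in Y then val (p v - k)%R else N + rk v.

Lemma cut_rk_cycle v : v \in Y -> cut_rk v < N.
Proof. by move=> vY; rewrite /cut_rk vY; apply: ltn_ord. Qed.

Lemma cut_forest : forest G [set y k] setT cut_par cut_rk.
Proof.
move=> x _; rewrite in_set1 => xk; rewrite inE /cut_par.
have [xY|xY] := boolP (x \in Y); last first.
  have [_ adj lt] := Dforest (in_setT x) xY; split=> //.
  rewrite [ltnRHS]/cut_rk (negbTE xY); have [/cut_rk_cycle|pY] := boolP (par x \in Y).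
    by move/leq_trans; apply; rewrite leq_addr.
  by rewrite /cut_rk (negbTE pY) ltn_add2l.
have ex := cycle_memP xY; have pk : p x != k by apply: contra_neq xk => <-.
rewrite (negbTE pk); split=> //.
  by rewrite {2}ex -{2}[p x](subrK 1%R) y_adj.
rewrite /cut_rk xY cycle_mem p_y addrAC Zp_val_subr1 ?subr_eq0 //.
rewrite prednK // lt0n; apply: contraNneq pk => e.
by rewrite -subr_eq0; apply/eqP/val_inj.
Qed.

Lemma cut_par_root : cut_par (y k) = y k.
Proof. by rewrite /cut_par cycle_mem p_y eqxx. Qed.

Lemma cut_par_D x : cut_par x \in D.
Proof.
rewrite /cut_par; case: ifP => [xY|/negbT/parD//].
by case: ifP => _; apply: (subsetP YD); rewrite ?cycle_mem.
Qed.

(** Off the cycle, [p] is constant along parents; on it, passing to the parent lowers [p v - k] by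
    one until the root is reached. *)
Lemma cut_descendants i :
  descendants cut_par (y (k + i)%R) = [set v | val i <= val (p v - k)%R].
Proof.
have lt_par v : v != y k -> cut_rk (cut_par v) < cut_rk v.
  by move=> vk; have [] := cut_forest (in_setT v); rewrite ?in_set1.
apply/setP=> v; have [K] := ubnP (cut_rk v); elim: K v => // K IHK v leK.
have [ev|vk] := eqVneq v (y k).
  rewrite ev [RHS]inE p_y subrr leqn0.
  have -> : (val i == 0) = (i == 0%R) by [].
  have [->|i0] := eqVneq i 0%R; first by rewrite addr0 in_descendants_par eqxx.
  apply/negP; rewrite inE => /iter_findex; rewrite iter_fix ?cut_par_root //.
  move/y_inj/eqP; rewrite -{1}[k]addr0 (inj_eq (addrI k)) eq_sym; exact/negP.
rewrite in_descendants_par IHK; last exact: leq_trans (lt_par v vk) leK.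
rewrite !inE /cut_par; case: ifP => vY; last first.
  rewrite -p_par ?vY //; case: eqVneq => // e.
  by rewrite e cycle_mem in vY.
have ev := cycle_memP vY; have pk : p v != k by apply: contra_neq vk => <-.
rewrite (negbTE pk) p_y addrAC Zp_val_subr1 ?subr_eq0 //.
rewrite {1}ev (inj_eq y_inj) [(k + i)%R]addrC -subr_eq -(inj_eq val_inj).
have : val (p v - k)%R != 0.
  by apply: contraNneq pk => e; rewrite -subr_eq0; apply/eqP/val_inj.
by move: (val _) (val i) => a b; nat_lia.
Qed.

Lemma cut_wiener : exists2 T, spanning_tree G T &
  4 * wiener T <= 4 * \sum_(i : 'I_N) cut_size p k i * (n - cut_size p k i)
                  + (#|D| - N) * n ^ 2 + 4 * (n - #|D|) * (n - 1).
Proof.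
have [T sT leW] := spanning_tree_of_forest cut_forest cut_par_root; exists T => //.
apply: leq_trans (leq_mul (leqnn 4) leW) _.
have kD : y k \in D by rewrite (subsetP YD) ?cycle_mem.
rewrite (wiener_split kD cut_par_D) leq_add2r.
pose s x := #|descendants cut_par x|.
apply: (@leq_trans (\sum_(x in D) 4 * (s x * (n - s x)))).
  by rewrite [leqRHS](big_setD1 (y k)) //= leq_addl.
rewrite (big_setID Y) /= (setIidPr YD); apply: leq_add.
  rewrite big_imset /=; last by move=> i j _ _; apply: y_inj.
  rewrite big_distrr /= (reindex_inj (addrI k)).
  by apply: leq_sum => i _; rewrite /s cut_descendants.
have -> : #|D| - N = #|D :\: Y|.
  by rewrite cardsD (setIidPr YD) card_imset // card_ord.
by rewrite -sum_nat_const; apply: leq_sum => x _; apply: four_mul_compl_le.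
Qed.
End Cut.

End Cycle.

(** Indices are added modulo [m.+2], so the adjacency hypothesis includes the closing edge. The core
    is a forest rooted at the whole cycle, and the cycle is cut at the best position. *)
Lemma cycle_spanning_tree (V : finType) (G : sgraph V) m (y : 'I_m.+2 -> V) (D : {set V}) :
  injective y -> (forall i, G (y i) (y (i + 1)%R)) -> (forall i, y i \in D) ->
  set_connected G D -> dominating G D ->
  exists2 T, spanning_tree G T &
    12 * m.+2 * wiener T <= 2 * #|V| ^ 2 * (m.+2 ^ 2 - 1)
      + 3 * m.+2 * (#|D| - m.+2) * #|V| ^ 2 + 12 * m.+2 * (#|V| - #|D|) * (#|V| - 1).
Proof.
move=> y_inj y_adj yD cD /dominatingP dD; pose Y := [set y i | i : 'I_m.+2].
have YD : Y \subset D by apply/subsetP=> _ /imsetP[i _ ->].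
have [|par0 [rk0 f0]] := @forest_grow V G Y D cD YD.
  by apply/set0Pn; exists (y 0%R); apply: imset_f.
have [|par [rk [f ag pd]]] := @forest_attach V G Y D setT par0 rk0 f0.
  by move=> x _; apply: dD.
rewrite setUT in f.
have parD x : x \notin Y -> par x \in D.
  move=> xY; have [xD|/pd->//] := boolP (x \in D).
  by rewrite ag //; case: (f0 x xD xY).
have [pr [prY prid prpar]] := forest_projection f.
pose p v : 'I_m.+2 := odflt 0%R [pick i | y i == pr v].
have p_pr v : y (p v) = pr v.
  rewrite /p; case: pickP => [i /eqP //|none].
  by case/imsetP: (prY v) => i _ e; have := none i; rewrite e eqxx.
have p_y i : p (y i) = i by apply: y_inj; rewrite p_pr prid ?imset_f.
have p_par v : v \notin Y -> p v = p (par v).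
  by move=> vY; apply: y_inj; rewrite !p_pr prpar.
have [k le] := exists_good_cut p.
have [T sT leW] := cut_wiener y_inj y_adj YD f parD p_y p_par k.
exists T => //; move: le leW.
move: (\sum_i _) (wiener T) => X W.
move: (#|V| - #|D|) (#|V| - 1) (#|V| ^ 2) (#|D| - m.+2) => c d n2 b.
move: (m.+2 ^ 2 - 1) m.+2 => N2 N le leW.
apply: leq_trans (_ : 3 * N * (4 * X + b * n2 + 4 * c * d) <= _).
  by rewrite [leqLHS](_ : _ = 3 * N * (4 * W)) ?leq_mul2l ?leW ?orbT //; ring.
rewrite [leqLHS](_ : _ = 2 * (6 * N * X) + 3 * N * b * n2 + 12 * N * c * d); last by ring.
by rewrite !leq_add2r -(mulnA 2 n2) leq_mul2l.
Qed.

(** * Greedy connected dominating sets *)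

Section Scaffolds.
Variables (V : finType) (G : sgraph V).
Implicit Types A D : {set V}.

Lemma independentP A : reflect {in A &, forall u v, G u v = false} (independent G A).
Proof.
apply: (iffP forall_inP) => [h u v uA vA|h u uA].
  by apply/negbTE; move/forall_inP: (h u uA); apply.
by apply/forall_inP => v vA; rewrite h.
Qed.

Lemma independent_card A : independent G A -> #|A| <= indep_number G.
Proof. by move=> iA; apply: (leq_bigmax_cond (F := fun A : {set V} => #|A|)). Qed.

Lemma adj_neq u v : G u v -> u != v.
Proof. by apply: contraTneq => ->; rewrite adj_irr. Qed.

(* A greedily grown independent set [A] with the connectors [D :\: A] joining it. *)
Definition scaffold A D : Prop :=
  [/\ A \subset D, set_connected G D, independent G A
    & forall c, c \in D -> c \notin A ->
        exists a b, [/\ a \in A, b \in A, a != b, G c a & G c b]].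

(** If [A] does not dominate, connectedness gives a vertex [v] at distance two from [A], reached
    through some [c]. Adding [v] to [A], and [v] and [c] to [D], never increases
    [#|D| - 2 * #|A|]. *)
Lemma scaffold_saturate A D :
  connected G -> A != set0 -> scaffold A D ->
  exists A' D', [/\ scaffold A' D', dominating G A', A' != set0
                 & #|D'| + 2 * #|A| <= #|D| + 2 * #|A'|].
Proof.
move=> cG; have [k] := ubnP (#|V| - #|A|); elim: k A D => // k IHk A D lek neA scA.
have [sAD cD iA two] := scA.
have [dA|ndA] := boolP (dominating G A); first by exists A, D; split.
pose S := [set x | (x \in A) || [exists y in A, G y x]].
have [||v [c [_ vS cS cv]]] := set_connected_boundary (S := S) (set_connectedT cG).
- rewrite properE subsetT; apply: contra ndA => /subsetP sub.
  by apply/forallP=> x; have := sub x (in_setT x); rewrite inE.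
- by case/set0Pn: neA => a aA; apply/set0Pn; exists a; rewrite inE aA.
have vA : v \notin A by apply: contraNN vS => vA; rewrite inE vA.
have vAn a : a \in A -> G a v = false.
  move=> aA; apply: contraNF vS => av; rewrite inE; apply/orP; right.
  by apply/exists_inP; exists a.
have cA : c \notin A by apply/negP=> /vAn; rewrite cv.
have [a aA ac] : exists2 a, a \in A & G a c.
  by apply/exists_inP; move: cS; rewrite inE (negbTE cA).
pose A1 := v |: A; pose D1 := v |: (c |: D).
have cardA1 : #|A1| = #|A|.+1 by rewrite cardsU1 vA.
have cardD1 : #|D1| <= #|D| + 2.
  by rewrite /D1 !cardsU1; case: (_ \notin _); case: (_ \notin _); nat_lia.
have [|||A' [D' [sc' d' ne' le']]] := IHk A1 D1.
- have := max_card A1; rewrite cardA1; nat_lia.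
- by apply/set0Pn; exists v; rewrite setU11.
- split.
  + apply: setUS; exact: subset_trans sAD (subsetUr _ _).
  + apply: (@set_connectedU1 _ _ _ _ c); rewrite ?setU11 //.
    by apply: (@set_connectedU1 _ _ _ _ a) => //; apply: (subsetP sAD).
  + apply/independentP=> x y /setU1P[->|xA] /setU1P[->|yA]; rewrite ?adj_irr ?vAn //.
      by rewrite adj_sym vAn.
    exact: (independentP _ iA).
  + move=> x xD1; rewrite in_setU1 negb_or => /andP[xv xA].
    have [->|xc] := eqVneq x c.
      exists a, v; rewrite !in_setU1 aA eqxx orbT (adj_sym _ c) ac cv; split=> //.
      by apply: contraNneq vA => <-.
    have xD : x \in D by move: xD1; rewrite !in_setU1 (negbTE xv) (negbTE xc).
    have [a' [b' [? ? ? ? ?]]] := two x xD xA.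
    by exists a', b'; rewrite !in_setU1; split=> //; apply/orP; right.
by exists A', D'; split=> //; nat_lia.
Qed.

Lemma scaffold1 a : scaffold [set a] [set a].
Proof.
split; rewrite ?set_connected1 //; last by move=> c ->.
by apply/independentP=> x y /set1P-> /set1P->; rewrite adj_irr.
Qed.

(** Three independent vertices share one connector, so [#|D| - 2 * #|A|] starts at -2 here and not
    at -1 as for a single vertex. *)
Lemma scaffold_claw c a b d :
  G c a -> G c b -> G c d -> G a b = false -> G a d = false -> G b d = false ->
  a != b -> a != d -> b != d -> scaffold [set a; b; d] (c |: [set a; b; d]).
Proof.
move=> ca cb cd ab ad bd nab nad nbd; split; first exact: subsetUr.
- have cc := set_connected1 G c; rewrite setUC -!setUA.
  apply: (@set_connectedU1 _ _ _ _ c) ca; last by rewrite !inE eqxx !orbT.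
  apply: (@set_connectedU1 _ _ _ _ c) cb; last by rewrite !inE eqxx !orbT.
  by apply: (@set_connectedU1 _ _ _ _ c) cd; rewrite ?inE ?eqxx.
- apply/independentP=> x y; rewrite !inE -!orbA.
  by case/or3P=> /eqP-> /or3P[]/eqP->; rewrite ?adj_irr ?ab ?ad ?bd // adj_sym.
move=> x xD xA; have -> : x = c by move: xD; rewrite in_setU1 (negbTE xA) orbF => /eqP.
by exists a, b; rewrite !inE !eqxx orbT.
Qed.
End Scaffolds.

(** * Graphs without a small connected dominating set *)

Definition claw_free (V : finType) (G : sgraph V) : Prop :=
  forall c a b d, G c a -> G c b -> G c d -> a != b -> a != d -> b != d ->
    G a b = false -> G a d = false -> G b d = false -> False.

Section Extremal.
Variables (V : finType) (G : sgraph V) (alpha : nat).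
Hypothesis alpha_max : forall B : {set V}, independent G B -> #|B| <= alpha.
Hypothesis alpha_gt1 : 1 < alpha.
Hypothesis no_small_cds : forall D, set_connected G D -> dominating G D ->
  D != set0 -> 2 * alpha <= #|D| + 1.
Hypothesis clawfree : claw_free G.
Variables A D : {set V}.
Hypothesis scAD : scaffold G A D.
Hypothesis domA : dominating G A.
Hypothesis cardA : #|A| = alpha.
Hypothesis cardD : #|D| + 1 = 2 * alpha.

Let sAD : A \subset D. Proof. by case: scAD. Qed.
Let cD : set_connected G D. Proof. by case: scAD. Qed.
Let iA a b : a \in A -> b \in A -> G a b = false.
Proof. by case: scAD => _ _ /independentP h _; apply: h. Qed.
Let AD a : a \in A -> a \in D. Proof. exact: (subsetP sAD). Qed.

(** * Connectors and non-cut vertices of the core *)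

Lemma dominating_super (S S' : {set V}) :
  S \subset S' -> dominating G S -> dominating G S'.
Proof.
move=> /subsetP sub /dominatingP d; apply/dominatingP=> x xS'.
have [|y yS yx] := d x; first by apply: contraNN xS' => /sub.
by exists y; rewrite ?sub.
Qed.

Lemma connector_other c a :
  c \in D -> c \notin A -> exists b, [/\ b \in A, b != a & G c b].
Proof.
move=> cD' cA; have [_ _ _ /(_ c cD' cA)[x [y [xA yA xy cx cy]]]] := scAD.
have [xa|] := eqVneq x a; last by exists x.
by exists y; rewrite -xa eq_sym.
Qed.

Lemma connector_nbrs c a b d : a \in A -> b \in A -> d \in A ->
  G c a -> G c b -> G c d -> a != b -> d = a \/ d = b.
Proof.
move=> aA bA dA ca cb cd ab.
have [|da] := eqVneq d a; first by left.
have [|db] := eqVneq d b; first by right.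
by case: (clawfree ca cb cd ab); rewrite 1?eq_sym ?iA.
Qed.

(** [A] alone dominates, so if [D :\ c] were connected it would be a connected dominating set with
    [2 * alpha - 2] vertices. *)
Lemma connector_cut c : c \in D -> c \notin A -> ~~ set_connected G (D :\ c).
Proof.
move=> cD' cA; apply/negP=> cc.
have sub : A \subset D :\ c by rewrite subsetD1 sAD cA.
have ne : D :\ c != set0.
  have /card_gt0P[a aA] : 0 < #|A| by rewrite cardA; nat_lia.
  by apply/set0Pn; exists a; apply: (subsetP sub).
have := no_small_cds cc (dominating_super sub domA) ne.
by have := cardsD1 c D; rewrite cD'; nat_lia.
Qed.

(** By claw-freeness every neighbour of [c] in [D] is, or is adjacent to, one of [a] and [b]. If
    these two stayed connected, so would all of [D :\ c]. *)
Lemma connector_separates c a b : c \in D -> c \notin A -> a \in A -> b \in A ->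
  a != b -> G c a -> G c b -> connect (induced G (D :\ c)) a b = false.
Proof.
move=> cD' cA aA bA ab ca cb; apply: contraNF (connector_cut cD' cA) => cab.
have inDc x : x \in A -> x \in D :\ c.
  by move=> xA; rewrite in_setD1 AD // andbT; apply: contraNneq cA => <-.
apply: (set_connectedD1 cD (inDc a aA)) => x xD cx.
have/setD1P[xc xD'] := xD.
have [xA|xA] := boolP (x \in A).
  by have [->//|->] := connector_nbrs aA bA xA ca cb cx ab; rewrite connect_induced_sym.
have xa : x != a by apply: contraNneq xA => ->.
have xb : x != b by apply: contraNneq xA => ->.
have [gxa|gxa] := boolP (G a x).
  by apply: connect1; rewrite inducedE xD inDc // adj_sym.
have [gxb|gxb] := boolP (G b x).
  rewrite connect_induced_sym in cab; apply: connect_trans (connect1 _) cab.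
  by rewrite inducedE xD inDc // adj_sym.
rewrite eq_sym in xa; rewrite eq_sym in xb.
by case: (clawfree ca cb cx ab xa xb (iA aA bA)); apply/negbTE.
Qed.

(* The vertices of [D] outside [A] are all cut vertices of [G[D]], so [noncut]
   vertices lie in [A]; deleting one destroys domination, not connectedness. *)
Definition noncut a := (a \in D) && set_connected G (D :\ a).

Lemma noncutA a : noncut a -> a \in A.
Proof. by case/andP=> aD ca; apply: contraTT ca => /(connector_cut aD). Qed.

Definition private_nbr a z :=
  [/\ z \notin D, G a z & forall x, x \in D -> x != a -> G x z = false].

Lemma exists_nbr a : a \in D -> exists2 x, x \in D & G a x.
Proof.
move=> aD; have [||x [y [xD xa /set1P -> ax]]] := set_connected_boundary (S := [set a]) cD.
- by rewrite properEcard sub1set aD cards1; nat_lia.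
- by apply/set0Pn; exists a; rewrite set11.
by exists x.
Qed.

(** [D :\ a] is connected but too small to dominate. A vertex it misses is not [a], which has a
    neighbour in [D], and being dominated by [D] it is adjacent to [a]. *)
Lemma noncut_private a : noncut a -> exists z, private_nbr a z.
Proof.
move=> La; have aA := noncutA La; have/andP[aD ca] := La.
have [b bD ab] := exists_nbr aD.
have ba : b != a by rewrite eq_sym (adj_neq ab).
have nd : ~~ dominating G (D :\ a).
  apply/negP=> da; have := no_small_cds ca da; have := cardsD1 a D; rewrite aD.
  suff -> : D :\ a != set0 by move=> ? /(_ isT); nat_lia.
  by apply/set0Pn; exists b; rewrite in_setD1 ba.
have /existsP[z] : [exists z, (z \notin D :\ a) && [forall y in D :\ a, ~~ G y z]].
  apply: contraR nd => /existsPn none; apply/dominatingP=> x xD.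
  have := none x; rewrite xD /= => /forall_inPn[y yD].
  by rewrite negbK; exists y.
case/andP=> zD /forall_inP nz.
have nza x : x \in D -> x != a -> G x z = false.
  by move=> xD xa; apply/negbTE/nz; rewrite in_setD1 xa.
have za : z != a by apply: contraTneq ab => <-; rewrite adj_sym nza.
have zD' : z \notin D by move: zD; rewrite in_setD1 za.
exists z; split=> //.
have/dominatingP dD := dominating_super sAD domA.
have [x xD xz] := dD z zD'.
by have [<-//|xa] := eqVneq x a; rewrite nza in xz.
Qed.

(** Two non-adjacent neighbours in [D] would form a claw with a private neighbour of [a]. *)
Lemma noncut_clique a : noncut a ->
  {in D &, forall x y, G a x -> G a y -> x != y -> G x y}.
Proof.
move=> La x y xD yD ax ay xy; have [z [zD az nz]] := noncut_private La.
apply: contraT => /negbTE nxy; have neq w : w \in D -> w != z.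
  by move=> wD; apply: contraNneq zD => <-.
case: (clawfree ax ay az); rewrite ?neq ?nz //.
  by rewrite eq_sym (adj_neq ax).
by rewrite eq_sym (adj_neq ay).
Qed.

Lemma noncut_outside S : set_connected G S -> S != set0 -> S \proper D ->
  exists2 w, noncut w & w \notin S.
Proof.
move=> cS neS pS; have [w /setDP[wD wS] cw] := noncut_vertex_outside cD cS neS pS.
by exists w; rewrite // /noncut wD.
Qed.

Lemma four_noncut_spanning_tree (E : {set V}) :
  #|E| = 4 -> {in E, forall x, noncut x} ->
  exists2 T, spanning_tree G T &
    4 * wiener T <= (2 * alpha - 3) * #|V| ^ 2 + 4 * (#|V| - (2 * alpha - 1)) * (#|V| - 1).
Proof.
move=> cardE LE.
have EA : E \subset A by apply/subsetP=> x /LE/noncutA.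
have ED : E \subset D by apply: subset_trans EA sAD.
have alpha4 : 4 <= alpha by rewrite -cardE -cardA subset_leq_card.
(* The vertices of [F] are deleted one at a time; the neighbours of each in [D] form a clique, so
   connectedness survives. *)
have rem (F : {set V}) : F \subset E -> set_connected G (D :\: F).
  have [k] := ubnP #|F|; elim: k F => // k IHk F lek FE.
  have [->|[x xF]] := set_0Vmem F; first by rewrite setD0.
  have xE := subsetP FE x xF.
  have eq : D :\: F = (D :\: (F :\ x)) :\ x.
    apply/setP=> w; rewrite !inE; have [->|//] := eqVneq w x; by rewrite xF.
  have := cardsD1 x F; rewrite xF => cF.
  have sub : F :\ x \subset E by apply: subset_trans (subsetDl _ _) FE.
  have := cardsD D (F :\ x); rewrite (setIidPr (subset_trans sub ED)) => cDF.
  have := subset_leq_card FE; rewrite cardE => F4.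
  rewrite eq; apply: set_connectedD1_clique.
  - by apply: IHk => //; nat_lia.
  - by rewrite !inE eqxx (subsetP ED).
  - by nat_lia.
  move=> a b /setDP[aD _] /setDP[bD _]; exact: (noncut_clique (LE x xE)).
have cardS : #|D :\: E| = 2 * alpha - 5.
  by rewrite cardsD (setIidPr ED) cardE; nat_lia.
have [||||||T sT leW] := @four_leaves_spanning_tree V G (D :\: E) E.
- exact: rem.
- by rewrite -card_gt0 cardS; nat_lia.
- exact: cardE.
- by rewrite disjoint_sym disjoints_subset; apply/subsetP=> x xE; rewrite !inE xE.
- move=> x xE; have xA := subsetP EA x xE; have [y yD xy] := exists_nbr (AD xA).
  exists y; last by rewrite adj_sym.
  rewrite inE yD andbT; apply/negP=> /(subsetP EA) yA; by rewrite iA in xy.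
- have -> : D :\: E :|: E = D.
    apply/setP=> x; rewrite !inE.
    by have [/(subsetP ED)->|_] := boolP (x \in E); rewrite ?orbT ?orbF.
  exact: dominating_super domA.
exists T => //; apply: leq_trans leW _; rewrite cardS.
have -> : 2 * alpha - 5 + 4 = 2 * alpha - 1 by nat_lia.
by have -> : 2 * alpha - 5 + 2 = 2 * alpha - 3 by nat_lia.
Qed.

(** * Alternating paths in the core *)

(* Only consecutive connectors are required to be non-adjacent: since every
   connector separates its two [A]-neighbours in [D], this local condition already
   makes the path injective and induced. *)
Definition alt_path (q : nat -> V) m : Prop :=
  [/\ odd m, forall i, i < m -> q i \in D, forall i, i < m -> (q i \in A) = ~~ odd i,
      forall i, i.+1 < m -> G (q i) (q i.+1)
    & forall i, i.+2 < m -> q i != q i.+2 /\ G (q i) (q i.+2) = false].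

Lemma alt_prefix q m k : alt_path q m -> odd k -> k <= m -> alt_path q k.
Proof.
move=> [_ inD inA adj two] ok km; split=> // i ik.
- by apply: inD; nat_lia.
- by apply: inA; nat_lia.
- by apply: adj; nat_lia.
by apply: two; nat_lia.
Qed.

Lemma alt_rev q m : alt_path q m -> alt_path (fun i => q (m.-1 - i)) m.
Proof.
move=> [om inD inA adj two]; split=> // i im.
- by apply: inD; nat_lia.
- by rewrite inA; nat_lia.
- by have -> : m.-1 - i = (m.-1 - i.+1).+1; [nat_lia|rewrite adj_sym; apply: adj; nat_lia].
have -> : m.-1 - i = (m.-1 - i.+2).+2 by nat_lia.
by rewrite eq_sym adj_sym; apply: two; nat_lia.
Qed.

Definition extend q m (c b : V) i := if i < m then q i else if i == m then c else b.

Lemma alt_extend q m c b : alt_path q m -> c \in D -> c \notin A -> b \in A ->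
  G (q m.-1) c -> G c b -> b != q m.-1 ->
  (1 < m -> q m.-2 != c /\ G (q m.-2) c = false) ->
  alt_path (extend q m c b) m.+2.
Proof.
move=> [om inD inA adj two] cD' cA bA qc cb bq fresh.
have m0 : 0 < m by nat_lia.
have em : extend q m c b m = c by rewrite /extend ltnn eqxx.
have em1 : extend q m c b m.+1 = b by rewrite /extend ltnNge leqnSn /= gtn_eqF.
have lo i : i < m -> extend q m c b i = q i by rewrite /extend => ->.
have last i : i.+1 = m -> q m.-1 = q i by move=> <-.
split; first by rewrite /= negbK.
- move=> i im; have [lti|mi] := ltnP i m; first by rewrite lo ?inD.
  have [->|->] : i = m \/ i = m.+1 by nat_lia.
    by rewrite em.
  by rewrite em1 AD.
- move=> i im; have [lti|mi] := ltnP i m; first by rewrite lo // inA.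
  have [->|->] : i = m \/ i = m.+1 by nat_lia.
    by rewrite em om (negbTE cA).
  by rewrite em1 bA /= om.
- move=> i im; have [lti|mi] := ltnP i.+1 m; first by rewrite !lo ?adj //; nat_lia.
  have [e|e] : i.+1 = m \/ i = m by nat_lia.
    by rewrite e em lo -?e // -(last _ e).
  by rewrite e em em1.
move=> i im; have [lti|mi] := ltnP i.+2 m; first by rewrite !lo; [apply: two|nat_lia|nat_lia].
have [e|e] : i.+2 = m \/ i.+1 = m by nat_lia.
  have e2 : m.-2 = i by nat_lia.
  by rewrite e em lo -?e // -e2; apply: fresh; nat_lia.
have e1 : m.-1 = i by nat_lia.
rewrite e em1 lo -?e // eq_sym -e1; split=> //.
by rewrite iA // inA; nat_lia.
Qed.

Lemma alt_connect q m c i j : alt_path q m -> i <= j < m ->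
  (forall k, i <= k <= j -> q k != c) -> connect (induced G (D :\ c)) (q i) (q j).
Proof.
move=> [_ inD _ adj _]; elim: j => [|j IHj] /andP[ij jm] nc.
  by have -> : i = 0 by nat_lia.
have [->//|lt] : i = j.+1 \/ i <= j by nat_lia.
apply: connect_trans (IHj _ _) (connect1 _); first by nat_lia.
  by move=> k kij; apply: nc; nat_lia.
by rewrite inducedE !in_setD1 !nc ?inD ?adj //; nat_lia.
Qed.

Lemma alt_nbr q m i a : alt_path q m -> i < m -> odd i -> a \in A -> G (q i) a ->
  a = q i.-1 \/ a = q i.+1.
Proof.
move=> [om _ inA adj two] im oi aA ga; have ei : i.-1.+1 = i by nat_lia.
have i1 : i.+1 < m by nat_lia.
have gm : G (q i) (q i.-1) by rewrite adj_sym -{2}ei adj // ei.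
apply: (connector_nbrs _ _ aA gm (adj i i1) ga).
- by rewrite inA; nat_lia.
- by rewrite inA; nat_lia.
- by rewrite -{2}ei; case: (two i.-1); rewrite ?ei.
Qed.

(** Induction on the length, removing the last connector [c] and the last vertex [b]; [a] is the
    vertex of [A] before [c]. *)
Lemma alt_inj_indep q m : alt_path q m ->
  (forall i j, i < m -> j < m -> q i = q j -> i = j) /\
  (forall i j, i < m -> j < m -> odd i -> odd j -> G (q i) (q j) = false).
Proof.
have [k] := ubnP m; elim: k m => // k IHk m lek qm; have [om inD inA adj two] := qm.
case: m => [|[|m]] // in om lek qm inD inA adj two *.
  by split=> -[|i] [|j].
have om' : odd m by rewrite /= negbK in om.
have qm' : alt_path q m by apply: alt_prefix qm om' _; nat_lia.
have [|inj ind] := IHk m _ qm'; first by nat_lia.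
have m0 : 0 < m by nat_lia.
have inC i : i < m.+2 -> odd i -> q i \notin A by move=> im oi; rewrite inA ?oi.
have inE' i : i < m.+2 -> ~~ odd i -> q i \in A by move=> im oi; rewrite inA.
have parity i j : i < m.+2 -> j < m.+2 -> q i = q j -> odd i = odd j.
  by move=> im jm e; apply: negb_inj; rewrite -!inA ?e.
have nbr i a := @alt_nbr q m i a qm'.
pose a := q m.-1; pose c := q m; pose b := q m.+1.
have em : m.-1.+1 = m by nat_lia.
have aA : a \in A by apply: inE'; nat_lia.
have bA : b \in A by apply: inE'; rewrite //= om'.
have cA : c \notin A by apply: inC; rewrite ?om' //; nat_lia.
have cD' : c \in D by apply: inD; nat_lia.
have ac : G a c by rewrite /a /c -{2}em; apply: adj; nat_lia.
have cb : G c b by apply: adj; nat_lia.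
have ab : a != b by rewrite /a /b -{2}em; case: (two m.-1) => //; nat_lia.
(* An earlier copy of [c] would be adjacent to [a], hence be the connector just before [a], which
   the path condition excludes. *)
have cnew i : i < m -> q i != c.
  move=> im; apply/eqP=> e; have oi : odd i by rewrite (parity i m) //; nat_lia.
  have ga : G (q i) a by rewrite e adj_sym.
  have i2 : i.+2 = m.
    case: (nbr i a im oi aA ga) => /inj; rewrite /a; nat_lia.
  by case: (two i); rewrite ?i2 ?e ?eqxx //; nat_lia.
(* An earlier copy of [b] would be joined to [a] along the path, avoiding [c], although [c]
   separates them. *)
have bnew i : i < m -> q i != b.
  move=> im; apply/eqP=> e.
  have := connector_separates cD' cA aA bA ab; rewrite adj_sym ac cb => /(_ isT isT).
  rewrite -e connect_induced_sym (alt_connect qm) //; first by nat_lia.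
  by move=> j jm; apply: cnew; nat_lia.
have bnbr i : i < m -> odd i -> G (q i) b = false.
  move=> im oi; apply/negP=> gb; have ip : i.+1 < m.
    have : i.+1 != m by apply: contraTneq om' => <-; rewrite /= oi.
    by nat_lia.
  case: (nbr i b im oi bA gb) => e; first by have := @bnew i.-1; rewrite e eqxx; nat_lia.
  by have := @bnew i.+1; rewrite e eqxx; nat_lia.
(* An earlier connector adjacent to [c] would, unless it directly precedes [a], form a claw at [c]
   with [a] and [b]. *)
have cind i : i < m -> odd i -> G (q i) c = false.
  move=> im oi; have [i2|i2] := eqVneq i.+2 m.
    by rewrite /c -i2; case: (two i) => //; nat_lia.
  apply/negP=> gc; have ca : G c a by rewrite adj_sym.
  have cq : G c (q i) by rewrite adj_sym.
  apply: (clawfree ca cb cq ab).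
  - by apply: contraTneq aA => ->; apply: inC; nat_lia.
  - by apply: contraTneq bA => ->; apply: inC; nat_lia.
  - exact: iA.
  - apply/negP; rewrite adj_sym => /(nbr i a im oi aA)[] /inj; rewrite /a; nat_lia.
  - by rewrite adj_sym bnbr.
have cases i : i < m.+2 -> [\/ i < m, i = m | i = m.+1].
  move=> im; have [->|[->|lt]] : i = m \/ i = m.+1 \/ i < m by nat_lia.
  - by constructor 2.
  - by constructor 3.
  by constructor 1.
have cneb : c != b by apply: contraNneq cA => ->.
split=> i j /cases[im|->|->] /cases[jm|->|->]; rewrite ?oddS ?om' ?adj_irr //.
- exact: inj.
- by move=> e; case/eqP: (cnew i im).
- by move=> e; case/eqP: (bnew i im).
- by move=> e; case/eqP: (cnew j jm).
- by move=> e; case/eqP: cneb.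
- by move=> e; case/eqP: (bnew j jm).
- by move=> e; case/eqP: cneb.
- by move=> oi oj; apply: ind.
- by move=> oi _; apply: cind.
- by move=> _ oj; rewrite adj_sym; apply: cind.
Qed.

(* If every connector at the end of the path were adjacent to the last one, the
   end could be deleted without disconnecting [D]. *)
Lemma alt_step q m : alt_path q m -> 1 < m -> ~~ noncut (q m.-1) ->
  exists c b, alt_path (extend q m c b) m.+2.
Proof.
move=> qm m1 cut; have [om inD inA adj two] := qm.
pose a := q m.-1; pose c0 := q m.-2.
have aD : a \in D by apply: inD; nat_lia.
have aA : a \in A by rewrite inA; nat_lia.
have e : m.-2.+1 = m.-1 by nat_lia.
have c0a : G c0 a by rewrite /c0 /a -e; apply: adj; nat_lia.
have c0D : c0 \in D by apply: inD; nat_lia.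
have c0D' : c0 \in D :\ a by rewrite in_setD1 c0D (adj_neq c0a).
have [/existsP[c /and5P[cD' cA ac c0c nc]]|none] :=
  boolP [exists c, [&& c \in D, c \notin A, G a c, c0 != c & ~~ G c0 c]].
  have [b [bA ba cb]] := connector_other a cD' cA.
  exists c, b; apply: alt_extend => // _; split=> //; exact/negbTE.
case/negP: cut; rewrite /noncut -/a aD; apply: (set_connectedD1 cD c0D') => x xD ax.
have [->//|xc0] := eqVneq x c0; have/setD1P[xa xD'] := xD.
apply: connect1; rewrite inducedE xD c0D' adj_sym; apply: contraR none => gx.
apply/existsP; exists x; apply/and5P; split; rewrite // 1?eq_sym //.
by apply/negP=> xA; rewrite iA in ax.
Qed.

Lemma alt_bound q m : alt_path q m -> m <= #|D|.
Proof.
move=> qm; have [inj _] := alt_inj_indep qm; have [_ inD _ _ _] := qm.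
rewrite -[m]card_ord -(card_imset (f := fun i : 'I_m => q i)) => [|i j /inj e]; last first.
  by apply/val_inj/e.
by apply/subset_leq_card/subsetP=> _ /imsetP[i _ ->]; apply: inD.
Qed.

Lemma alt_complete q m : alt_path q m -> 1 < m ->
  exists q' m', [/\ alt_path q' m', m <= m', forall i, i < m -> q' i = q i
                  & noncut (q' m'.-1)].
Proof.
have [k] := ubnP (#|D| - m); elim: k q m => // k IHk q m lek qm m1.
have [Lm|/(alt_step qm m1)[c [b qm2]]] := boolP (noncut (q m.-1)); first by exists q, m.
have := alt_bound qm2 => leD.
have [||q' [m' [qm' le eq L']]] := IHk _ _ _ qm2; try nat_lia.
exists q', m'; split=> //; first by nat_lia.
by move=> i im; rewrite eq ?/extend ?im //; nat_lia.
Qed.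

(* Otherwise exchange the [A]-vertices of the path for its connectors together
   with [z] and [z']: an independent set of [alpha + 1] vertices. *)
Lemma alt_private_adj q m z z' : alt_path q m -> 1 < m ->
  private_nbr (q 0) z -> private_nbr (q m.-1) z' -> G z z'.
Proof.
move=> qm m1 [zD qz nz] [z'D qz' nz']; apply: contraT => /negbTE zz'.
have [inj ind] := alt_inj_indep qm; have [om inD inA adj two] := qm.
have q0m : q 0 != q m.-1 by apply/eqP=> /inj; nat_lia.
have zz : z != z'.
  have qD : q m.-1 \in D by apply: inD; nat_lia.
  by apply/eqP=> e; rewrite eq_sym in q0m; have := nz _ qD q0m; rewrite e qz'.
pose Ev := [set q i.*2 | i : 'I_(m./2).+1].
pose Od := [set q i.*2.+1 | i : 'I_m./2].
have em : (m./2).*2.+1 = m by rewrite -[RHS]odd_double_half om.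
have EvA : Ev \subset A.
  apply/subsetP=> _ /imsetP[i _ ->]; have lti := ltn_ord i; rewrite inA ?odd_double //; nat_lia.
have cEv : #|Ev| = (m./2).+1.
  rewrite card_imset ?card_ord // => i j /inj e; apply/ord_inj.
  by have := ltn_ord i; have := ltn_ord j; move: e; nat_lia.
have cOd : #|Od| = m./2.
  rewrite card_imset ?card_ord // => i j /inj e; apply/ord_inj.
  by have := ltn_ord i; have := ltn_ord j; move: e; nat_lia.
have OdP x : x \in Od -> exists i, [/\ i < m, odd i & x = q i].
  case/imsetP=> i _ ->; exists i.*2.+1; split=> //; last by rewrite /= odd_double.
  by have := ltn_ord i; nat_lia.
pose B := z |: (z' |: (Od :|: (A :\: Ev))).
have OdD x : x \in Od -> x \in D by case/OdP=> i [im _ ->]; apply: inD.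
have OdA x : x \in Od -> x \notin A by case/OdP=> i [im oi ->]; rewrite inA ?oi.
have RD x : x \in Od :|: (A :\: Ev) -> x \in D.
  by case/setUP=> [/OdD|/setDP[/AD]].
have evq i : i < m -> ~~ odd i -> q i \in Ev.
  move=> im ei; have lt : i./2 < (m./2).+1 by nat_lia.
  apply/imsetP; exists (Ordinal lt) => //=; congr q; nat_lia.
have Rz x : x \in Od :|: (A :\: Ev) -> x != q 0 /\ x != q m.-1.
  have ev i : i < m -> ~~ odd i -> x \in Od :|: (A :\: Ev) -> x != q i.
    move=> im ei xR; apply/eqP=> e; case/setUP: xR => [/OdA|/setDP[_]].
      by rewrite e inA // ei.
    by rewrite e evq.
  by move=> xR; rewrite !ev //; nat_lia.
have cardB : #|B| = alpha + 1.
  rewrite !cardsU1 !inE (negbTE zz) /=.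
  have -> : (z \in Od) = false by apply: contraNF zD => /OdD.
  have -> : (z \in A) = false by apply: contraNF zD => /AD.
  have -> : (z' \in Od) = false by apply: contraNF z'D => /OdD.
  have -> : (z' \in A) = false by apply: contraNF z'D => /AD.
  rewrite !andbF /= cardsU cOd cardsD (setIidPr EvA) cEv cardA.
  have -> : Od :&: (A :\: Ev) = set0.
    by apply/setP=> x; rewrite !inE; apply/and3P=> -[/OdA/negP nA _].
  rewrite cards0; have := subset_leq_card EvA; rewrite cEv cardA; nat_lia.
suff /alpha_max : independent G B by rewrite cardB addn1 ltnn.
have indR : {in Od :|: (A :\: Ev) &, forall x y, G x y = false}.
  have OdAE x y : x \in Od -> y \in A :\: Ev -> G x y = false.
    case/OdP=> i [im oi ->] /setDP[yA yE]; apply/negP=> gy.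
    have i1 : i.+1 < m by nat_lia.
    case: (alt_nbr qm im oi yA gy) => e; case/negP: yE; rewrite e evq //; nat_lia.
  move=> x y /setUP[xO|xA] /setUP[yO|yA].
  - by have [i [im oi ->]] := OdP x xO; have [j [jm oj ->]] := OdP y yO; apply: ind.
  - exact: OdAE.
  - by rewrite adj_sym; apply: OdAE.
  - by case/setDP: xA => xA _; case/setDP: yA => yA _; apply: iA.
have zR x : x \in Od :|: (A :\: Ev) -> G x z = false /\ G x z' = false.
  by move=> xR; have [x0 xm] := Rz x xR; rewrite nz ?nz' ?RD.
have zB y : y \in B -> G z y = false.
  case/setU1P=> [->|/setU1P[->|/zR[yz _]]]; rewrite ?adj_irr ?zz' //.
  by rewrite adj_sym.
have z'B y : y \in B -> G z' y = false.
  case/setU1P=> [->|/setU1P[->|/zR[_ yz]]]; rewrite ?adj_irr ?(adj_sym _ z') ?zz' //.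
apply/independentP=> x y /setU1P[->|/setU1P[->|xR]] yB; rewrite ?zB ?z'B //.
case/setU1P: yB => [->|/setU1P[->|yR]]; first by case: (zR x xR).
  by case: (zR x xR).
exact: indR.
Qed.

(** Adjacent private neighbours [z'] of the last and [z] of the first vertex close the path to a
    cycle of length [m + 2]; adding them to the core gives [2 * alpha + 1] vertices. *)
Lemma alt_cycle_spanning_tree q m : alt_path q m -> 1 < m ->
  noncut (q 0) -> noncut (q m.-1) ->
  exists2 T, spanning_tree G T &
    [/\ 2 * alpha + 1 <= #|V|, m.+2 <= 2 * alpha + 1 &
    12 * m.+2 * wiener T <= 2 * #|V| ^ 2 * (m.+2 ^ 2 - 1)
      + 3 * m.+2 * (2 * alpha + 1 - m.+2) * #|V| ^ 2
      + 12 * m.+2 * (#|V| - (2 * alpha + 1)) * (#|V| - 1)].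
Proof.
move=> qm m1 L0 Lm.
have [z pz] := noncut_private L0; have [z' pz'] := noncut_private Lm.
have zz' := alt_private_adj qm m1 pz pz'.
have [zD qz _] := pz; have [z'D qz' _] := pz'.
have [inj _] := alt_inj_indep qm; have [om inD inA adj two] := qm.
have leD := alt_bound qm.
pose D' := z |: (z' |: D).
have cardD' : #|D'| = 2 * alpha + 1.
  have zD1 : z \notin z' |: D by rewrite in_setU1 negb_or zD andbT (adj_neq zz').
  by rewrite !cardsU1 zD1 z'D; nat_lia.
pose y (i : 'I_m.+2) := extend q m z' z i.
have lo (i : 'I_m.+2) : i < m -> y i = q i by rewrite /y /extend => ->.
have ym (i : 'I_m.+2) : i = m :> nat -> y i = z'.
  by rewrite /y /extend => ->; rewrite ltnn eqxx.
have ym1 (i : 'I_m.+2) : i = m.+1 :> nat -> y i = z.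
  by rewrite /y /extend => ->; rewrite ltnNge leqnSn /= gtn_eqF.
have cases (i : 'I_m.+2) : [\/ i < m, i = m :> nat | i = m.+1 :> nat].
  have := ltn_ord i => im.
  have [lt|[e|e]] : i < m \/ i = m :> nat \/ i = m.+1 :> nat by nat_lia.
  - by constructor 1.
  - by constructor 2.
  - by constructor 3.
have qnz i : i < m -> q i != z by move=> /inD qD; apply: contraNneq zD => <-.
have qnz' i : i < m -> q i != z' by move=> /inD qD; apply: contraNneq z'D => <-.
have [|||||T sT leW] := @cycle_spanning_tree V G m y D'.
- move=> i j; case: (cases i) => ei; case: (cases j) => ej;
    rewrite ?(lo _ ei) ?(lo _ ej) ?(ym _ ei) ?(ym _ ej) ?(ym1 _ ei) ?(ym1 _ ej) => e;
    apply/ord_inj; rewrite ?ei ?ej //.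
  + exact: inj.
  + by case/eqP: (qnz' i ei).
  + by case/eqP: (qnz i ei).
  + by case/eqP: (qnz' j ej).
  + by rewrite e adj_irr in zz'.
  + by case/eqP: (qnz j ej).
  + by rewrite e adj_irr in zz'.
- move=> i; have succ : i < m.+1 -> (i + 1)%R = i.+1 :> nat.
    by move=> im /=; rewrite [1 %% _]modn_small // addn1 modn_small.
  have wrap : i = m.+1 :> nat -> (i + 1)%R = 0 :> nat.
    by move=> im /=; rewrite [1 %% _]modn_small // im addn1 modnn.
  case: (cases i) => ei.
  + have [lt|e] : i.+1 < m \/ i.+1 = m by nat_lia.
      by rewrite !lo ?succ ?adj //; nat_lia.
    rewrite (lo _ ei) ym ?succ //; last by nat_lia.
    by have -> : i = m.-1 :> nat by nat_lia.
  + by rewrite (ym _ ei) ym1 ?succ ?ei // adj_sym.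
  + by rewrite (ym1 _ ei) lo wrap // ?(adj_sym _ z) //; nat_lia.
- move=> i; case: (cases i) => ei; rewrite ?(lo _ ei) ?(ym _ ei) ?(ym1 _ ei) !inE ?eqxx ?orbT //.
  by rewrite inD ?orbT.
- apply: (@set_connectedU1 _ _ _ _ z'); rewrite ?setU11 1?adj_sym //.
  apply: set_connectedU1 qz' => //; apply: inD; nat_lia.
- apply: dominating_super domA; apply: subset_trans sAD _.
  by apply/subsetP=> x xD; rewrite !inE xD !orbT.
exists T => //; split; first by rewrite -cardD' max_card.
  by nat_lia.
by rewrite -cardD'.
Qed.

(** If the path met the component of [b] in [D :\ c], it would join [q k] to [b] without using [c],
    which separates them. *)
Lemma alt_avoid q m c b w k : alt_path q m -> c \in D -> c \notin A ->
  (forall i, i < m -> q i != c) -> k < m -> ~~ odd k -> G (q k) c ->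
  b \in A -> b != q k -> G c b -> connect (induced G (D :\ c)) b w ->
  forall i, i < m -> q i != w.
Proof.
move=> qm cD' cA cq km ek kc bA bk cb bw i im; apply/eqP=> e.
have [om inD inA adj two] := qm.
have kA : q k \in A by rewrite inA.
rewrite adj_sym in kc; rewrite eq_sym in bk.
have := connector_separates cD' cA kA bA bk kc cb; rewrite -e in bw.
rewrite connect_induced_sym in bw; move/negP; apply; apply: connect_trans bw.
have [le|/ltnW le] := leqP k i.
  by apply: (alt_connect qm); [nat_lia | move=> j ?; apply: cq; nat_lia].
rewrite connect_induced_sym.
by apply: (alt_connect qm); [nat_lia | move=> j ?; apply: cq; nat_lia].
Qed.

(** The new path follows [q] up to [q k], leaves through [c], and is prolonged to a non-cut vertex.
    Beyond [c] it never returns to [c], so its end lies off [q]. *)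
Lemma alt_branch q m c k : alt_path q m -> c \in D -> c \notin A ->
  (forall i, i < m -> q i != c) -> k < m -> ~~ odd k -> G (q k) c ->
  (0 < k -> G (q k.-1) c = false) ->
  exists q' m', [/\ alt_path q' m', 1 < m', q' 0 = q 0, noncut (q' m'.-1)
                 & forall i, i < m -> q i != q' m'.-1].
Proof.
move=> qm cD' cA cq km ek kc kp; have [om inD inA adj two] := qm.
have [b [bA bk cb]] := connector_other (q k) cD' cA.
have pre : alt_path q k.+1 by apply: alt_prefix qm _ _.
have ext : alt_path (extend q k.+1 c b) k.+3.
  apply: alt_extend => //= k1; split; last by apply: kp; nat_lia.
  by apply: cq; nat_lia.
have [//|q' [m' [qm' le eq L']]] := alt_complete ext.
have q'0 : q' 0 = q 0 by rewrite eq.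
have q'c : q' k.+1 = c by rewrite eq // /extend ltnn eqxx.
have q'b : q' k.+2 = b by rewrite eq // /extend ltnNge leqnSn /= gtn_eqF.
exists q', m'; split=> //; first by nat_lia.
apply: (alt_avoid qm cD' cA cq km ek kc bA bk cb); rewrite -q'b.
have [inj _] := alt_inj_indep qm'.
apply: (alt_connect qm'); first by nat_lia.
by move=> j jm; rewrite -q'c; apply/eqP=> /inj; nat_lia.
Qed.

(** A path [q] between two non-cut vertices with fewer than [alpha] vertices misses part of [D];
    branching off gives a path [q'] to a third non-cut vertex. If both together still miss a vertex
    of [D], there is a fourth one; otherwise [q'] is long. *)
Lemma four_noncut_or_long_alt :
  (exists2 E : {set V}, #|E| = 4 & {in E, forall x, noncut x}) \/
  (exists q m, [/\ alt_path q m, 1 < m, noncut (q 0), noncut (q m.-1) & alpha <= m]).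
Proof.
have card3 : 2 < #|D| by nat_lia.
have [x xD] : exists x, x \in D by apply/card_gt0P; nat_lia.
have [|||u Lu _] := @noncut_outside [set x].
- exact: set_connected1.
- by apply/set0Pn; exists x; rewrite set11.
- by rewrite properEcard sub1set xD cards1; nat_lia.
have uA := noncutA Lu; have [c cD' uc] := exists_nbr (AD uA).
have cA : c \notin A by apply/negP=> cA; rewrite iA in uc.
have [b [bA bu cb]] := connector_other u cD' cA.
have alt1 : alt_path (fun=> u) 1.
  by split=> // -[|i] // _; rewrite ?AD ?uA.
have alt3 : alt_path (extend (fun=> u) 1 c b) 3 by apply: alt_extend.
have [//|q [m [qm m3 eq Lm]]] := alt_complete alt3.
have L0 : noncut (q 0) by rewrite eq.
have m1 : 1 < m by nat_lia.
have [le|lt] := leqP alpha m; first by right; exists q, m; split.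
pose Im (f : nat -> V) l := [set f (i : 'I_l) | i : 'I_l].
have ImP f l v : reflect (exists2 i, i < l & v = f i) (v \in Im f l).
  apply: (iffP imsetP) => [[i _ ->]|[i il ->]]; first by exists i.
  by exists (Ordinal il).
have ImD f l : alt_path f l -> Im f l \subset D.
  by move=> fl; apply/subsetP=> v /ImP[i il ->]; case: fl => _ inD _ _ _; apply: inD.
have cardIm f l : #|Im f l| <= l by rewrite -[leqRHS]card_ord leq_imset_card.
have Imconn f l : alt_path f l -> {in Im f l, forall v, connect (induced G (Im f l)) v (f 0)}.
  move=> [_ _ _ adj _] v /ImP[i il ->]; elim: i il => // i IHi il.
  apply: connect_trans (connect1 _) (IHi (ltnW il)).
  rewrite inducedE adj_sym adj // andbT; apply/andP; split; apply/ImP.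
    by exists i.+1.
  by exists i => //; apply: ltnW.
have qi i : i < m -> q i \in Im q m by move=> im; apply/ImP; exists i.
have pr : Im q m \proper D.
  by rewrite properEcard ImD //; apply: leq_ltn_trans (cardIm q m) _; nat_lia.
have neIm : Im q m != set0 by apply/set0Pn; exists (q 0); apply: qi; nat_lia.
have [w0 [y [wD wI /ImP[k km ->] kw]]] := set_connected_boundary cD pr neIm.
have [om inD inA adj two] := qm.
have wq i : i < m -> q i != w0 by move=> im; apply: contraNneq wI => <-; apply: qi.
(* A vertex of [A] next to the path is adjacent to one of its connectors, whose only two neighbours
   in [A] lie on the path. *)
have wA : w0 \notin A.
  apply/negP=> wA; have ok : odd k.
    by apply: contraTT kw => ek; rewrite iA // inA.
  have k1 : k.+1 < m by nat_lia.
  have km1 : k.-1 < m by nat_lia.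
  by case: (alt_nbr qm km ok wA kw) => e;
     [case/eqP: (wq _ km1) | case/eqP: (wq _ k1)].
(* If [w0] is attached at a connector, it is adjacent to one of the two path neighbours of that
   connector, for otherwise there is a claw. *)
have {k km kw} [k [km ek kw]] : exists k, [/\ k < m, ~~ odd k & G (q k) w0].
  have [ok|] := boolP (odd k); last by exists k.
  have ei : k.-1.+1 = k by nat_lia.
  have k1 : k.+1 < m by nat_lia.
  have km1 : k.-1 < m by nat_lia.
  have [g1|g1] := boolP (G (q k.-1) w0); first by exists k.-1; split=> //; nat_lia.
  have [g2|g2] := boolP (G (q k.+1) w0); first by exists k.+1; split=> //; nat_lia.
  have gm : G (q k) (q k.-1) by rewrite adj_sym -{2}ei adj // ei.
  case: (clawfree gm (adj k k1) kw); rewrite ?wq //; try exact: negbTE.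
  - by rewrite -{2}ei; case: (two k.-1); rewrite ?ei.
  - by rewrite -{2}ei; case: (two k.-1); rewrite ?ei.
have [b' [b'A b'k wb']] := connector_other (q k) wD wA.
have b'q := alt_avoid qm wD wA wq km ek kw b'A b'k wb' (connect0 _ _).
have [q' [m' [qm' m'1 q'0 L' q'new]]] : exists q' m', [/\ alt_path q' m', 1 < m',
    q' 0 \in Im q m, noncut (q' m'.-1) & noncut (q' 0) /\ forall i, i < m -> q i != q' m'.-1].
  (* When [w0] is adjacent to the connector before [q k], the branch is taken from the reversed
     path: adjacency to the connector after [q k] as well would give a claw at [w0] with [b']. *)
  have [/andP[k0 kp]|side] := boolP ((0 < k) && G (q k.-1) w0); last first.
    have [|q' [m' [qm' m'1 q'0 L' new]]] := alt_branch qm wD wA wq km ek kw.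
      by move=> k0; apply/negbTE; move: side; rewrite k0.
    by exists q', m'; rewrite q'0; split=> //; apply: qi; nat_lia.
  have rv i : i < m -> m.-1 - (m.-1 - i) = i by nat_lia.
  have mk : m.-1 - k < m by nat_lia.
  have [|||||||q' [m' [qm' m'1 q'0 L' new]]] :=
      @alt_branch _ _ w0 (m.-1 - k) (alt_rev qm); rewrite ?subn0 ?rv //.
  - by move=> i im; apply: wq; nat_lia.
  - by nat_lia.
  - move=> k0'; have -> : m.-1 - (m.-1 - k).-1 = k.+1 by nat_lia.
    have ei : k.-1.+1 = k by nat_lia.
    have k1 : k.+1 < m by nat_lia.
    have km1 : k.-1 < m by nat_lia.
    apply/negP=> gp; have nb j : j < m -> odd j -> G (q j) b' = false.
      move=> jm oj; apply/negP=> gj.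
      have j1 : j.+1 < m by nat_lia.
      have jm1 : j.-1 < m by nat_lia.
      by case: (alt_nbr qm jm oj b'A gj) => e;
        [case/eqP: (b'q _ jm1) | case/eqP: (b'q _ j1)].
    rewrite adj_sym in kp; rewrite adj_sym in gp.
    apply: (clawfree kp gp wb'); rewrite ?b'q ?nb //; try nat_lia.
    - by rewrite -{2}ei; case: (two k.-1); rewrite ?ei.
    - by rewrite -{2}ei; case: (two k.-1); rewrite ?ei.
  exists q', m'; rewrite q'0 subn0; split=> //; first by apply: qi; nat_lia.
  by split=> // i im; rewrite -(rv i im); apply: new; nat_lia.
case: q'new => L'0 q'new.
pose S := Im q m :|: Im q' m'.
have SD : S \subset D by rewrite subUset !ImD.
have cS : set_connected G S.
  apply: (@set_connected_hub _ _ _ (q 0)) => v /setUP[vI|vI].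
    exact: connect_induced_mono (subsetUl _ _) (Imconn _ _ qm v vI).
  apply: connect_trans (connect_induced_mono (subsetUr _ _) (Imconn _ _ qm' v vI)) _.
  exact: connect_induced_mono (subsetUl _ _) (Imconn _ _ qm _ q'0).
have neS : S != set0 by case/set0Pn: neIm => v vI; apply/set0Pn; exists v; rewrite inE vI.
have [eS|neq] := eqVneq S D.
  right; exists q', m'; split=> //.
  (* The paths share [q' 0], so [2 * alpha - 1 <= m + m' - 1], and [m < alpha] forces
     [m' > alpha]. *)
  have : 0 < #|Im q m :&: Im q' m'|.
    apply/card_gt0P; exists (q' 0); rewrite inE q'0 /=; apply/ImP; exists 0 => //; nat_lia.
  have := cardsU (Im q m) (Im q' m'); rewrite -/S eS.
  by have := cardIm q m; have := cardIm q' m'; nat_lia.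
have [|w Lw wS] := noncut_outside cS neS _; first by rewrite properEneq neq.
left; exists [set q 0; q m.-1; q' m'.-1; w]; last first.
  by move=> v; rewrite !inE -!orbA => /or4P[]/eqP->.
have [inj _] := alt_inj_indep qm.
have wne v : v \in S -> v != w by move=> vS; apply: contraNneq wS => <-.
have w1 : q 0 != w by rewrite wne // inE qi //; nat_lia.
have w2 : q m.-1 != w by rewrite wne // inE qi //; nat_lia.
have w3 : q' m'.-1 != w.
  by rewrite wne // inE orbC; apply/orP; left; apply/ImP; exists m'.-1 => //; nat_lia.
have v1 : q 0 != q' m'.-1 by apply: q'new; nat_lia.
have v2 : q m.-1 != q' m'.-1 by apply: q'new; nat_lia.
have u1 : q 0 != q m.-1 by apply/eqP=> /inj; nat_lia.
rewrite -!setUA !cardsU1 cards1 !inE.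
by rewrite (negbTE u1) (negbTE v1) (negbTE v2) (negbTE w1) (negbTE w2) (negbTE w3).
Qed.
End Extremal.

(** * The bound *)

(** The terms in [n^2] cancel, and the difference of the two bounds is [(3m + 1) n - 4m]. *)
Lemma core_arith W m n : 0 < m -> m <= n -> 1 < n ->
  4 * W <= (m - 1) * n ^ 2 + 4 * (n - m) * (n - 1) -> 4 * W < (m + 3) * n * (n - 1).
Proof.
move=> m0 mn n1; have [k en] : exists k, n = k.+2 by exists n.-2; nat_lia.
have [d ed] : exists d, n = m + d by exists (n - m); nat_lia.
have [l em] : exists l, m = l.+1 by exists m.-1; nat_lia.
rewrite {2}ed addKn em subn1 /= en subn1 /=; rewrite en em in ed.
have -> : d = k.+1 - l by nat_lia.
have : l <= k.+1 by nat_lia.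
rewrite -mulnn; nia.
Qed.

Lemma four_leaves_arith W m n : 2 < m -> m <= n ->
  4 * W <= (m - 2) * n ^ 2 + 4 * (n - m) * (n - 1) -> 4 * W < (m + 2) * n * (n - 1).
Proof.
move=> m0 mn; have [d ed] : exists d, n = m + d by exists (n - m); nat_lia.
have [l em] : exists l, m = l.+3 by exists (m - 3); nat_lia.
rewrite {2}ed addKn em; have -> : l.+3 - 2 = l.+1 by nat_lia.
have -> : n - 1 = l + d + 2 by nat_lia.
have -> : n = l + d + 3 by nat_lia.
rewrite -mulnn; nia.
Qed.

Local Open Scope ring_scope.

Lemma nat_avg_dist_lt (V : finType) (T : sgraph V) (K : nat) (q : rat) :
  (1 < #|V|)%N -> (4 * wiener T < K * #|V| * (#|V| - 1))%N -> K%:R <= 2 * q ->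
  avg_dist T < q.
Proof.
move=> n1 lt le; apply: avg_dist_lt => //.
move: lt; rewrite -(ltr_nat rat) !natrM natrB; last by nat_lia.
move=> lt; have P0 : 0 <= #|V|%:R * (#|V|%:R - 1) :> rat.
  by rewrite mulr_ge0 ?ler0n // subr_ge0 ler1n; nat_lia.
have := ler_wpM2r P0 le; lra.
Qed.

(** Here [M] is the core size, [N] the cycle length and [e] the excess over [M / 2]. The coefficient
    [N^2 - 12 N + 2] of [n^2] is positive for [N >= 12]; it is -9 for [N = 11] and -25 for [N = 9],
    where the bounds on [e] make [6 N e] at least 22 and 26. *)
Lemma cycle_arith (W N M n e : rat) :
  0 < N -> N <= M -> 2 <= n -> M <= n -> 0 <= e ->
  [\/ 12 <= N, N = 11 /\ 1 / 3 <= e | N = 9 /\ 26 / 54 <= e] ->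
  12 * N * W <= 2 * n ^+ 2 * (N ^+ 2 - 1) + 3 * N * (M - N) * n ^+ 2
    + 12 * N * (n - M) * (n - 1) ->
  2 * W < (M / 2 + e) * n * (n - 1).
Proof.
move=> N0 NM n2 Mn e0 cases le.
suff lt : 2 * n ^+ 2 * (N ^+ 2 - 1) + 3 * N * (M - N) * n ^+ 2
    + 12 * N * (n - M) * (n - 1) < 6 * N * ((M / 2 + e) * n * (n - 1)).
  rewrite -(ltr_pM2l (_ : 0 < 6 * N)); last by rewrite mulr_gt0.
  by apply: le_lt_trans lt; move: le; lra.
have NM0 : 0 <= N * M by nra.
have h1 : 12 * (N * M) <= 9 * (N * M) * n by nra.
have nn : 0 <= n * (n - 1) by apply: mulr_ge0; lra.
have en : 0 <= e * (n * (n - 1)) by apply: mulr_ge0.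
suff : 0 < n ^+ 2 * (N ^+ 2 - 12 * N + 2) + 6 * N * (e * (n * (n - 1))) + 12 * N * n by lra.
have Nn : 0 < N * n by apply: mulr_gt0 => //; lra.
case: cases => [N12|[-> e3]|[-> e3]].
- have : 0 <= n ^+ 2 * (N ^+ 2 - 12 * N + 2) by apply: mulr_ge0; nra.
  have : 0 <= N * (e * (n * (n - 1))) by apply: mulr_ge0 => //; lra.
  lra.
- have : 1 / 3 * (n * (n - 1)) <= e * (n * (n - 1)) by apply: ler_wpM2r.
  nra.
- have : 26 / 54 * (n * (n - 1)) <= e * (n * (n - 1)) by apply: ler_wpM2r.
  nra.
Qed.

Lemma cycle_avg_dist_lt (V : finType) (T : sgraph V) (m alpha : nat) :
  (6 < alpha)%N -> odd m -> (alpha <= m)%N -> (m.+2 <= 2 * alpha + 1)%N ->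
  (2 * alpha + 1 <= #|V|)%N ->
  (12 * m.+2 * wiener T <= 2 * #|V| ^ 2 * (m.+2 ^ 2 - 1)
      + 3 * m.+2 * (2 * alpha + 1 - m.+2) * #|V| ^ 2
      + 12 * m.+2 * (#|V| - (2 * alpha + 1)) * (#|V| - 1))%N ->
  avg_dist T < alpha%:R + 1 / 2 + 4 * (alpha%:R - 1) / alpha%:R ^+ 2.
Proof.
move=> a7 om am mM Mn le; apply: avg_dist_lt; first by nat_lia.
set e := 4 * (alpha%:R - 1) / alpha%:R ^+ 2.
have a0 : 7 <= alpha%:R :> rat by rewrite ler_nat.
have e0 : 0 <= e by rewrite /e !mulr_ge0 ?invr_ge0 ?exprn_ge0 //; lra.
have -> : alpha%:R + 1 / 2 + e = (2 * alpha + 1)%N%:R / 2 + e.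
  by rewrite natrD natrM; field.
have n2 : 2 <= #|V|%:R :> rat by rewrite (ler_nat _ 2); nat_lia.
have large : [\/ 12 <= m.+2%:R :> rat, m.+2%:R = 11 :> rat /\ 1 / 3 <= e
    | m.+2%:R = 9 :> rat /\ 26 / 54 <= e].
  have a20 : 0 < alpha%:R ^+ 2 :> rat by rewrite exprn_gt0 // ltr0n; nat_lia.
  have [N12|N11] := leqP 12 m.+2; first by constructor 1; rewrite (ler_nat _ 12).
  (* Parity excludes cycles of length 10. For [m = 9] the bound on [e] follows from
     [7 <= alpha <= 9]; for [m = 7] necessarily [alpha = 7] and [e = 24/49]. *)
  have [m9|m7] : m = 9 \/ m = 7 by nat_lia.
    constructor 2; rewrite m9; split; first by [].
    have a9 : alpha%:R <= 9 :> rat by rewrite (ler_nat _ _ 9); nat_lia.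
    by rewrite /e (ler_pdivlMr _ _ a20); nra.
  constructor 3; rewrite m7; split; first by [].
  have ea : alpha%:R = 7 :> rat by have -> : alpha = 7 by nat_lia.
  by rewrite /e (ler_pdivlMr _ _ a20) ea; lra.
have N0 : 0 < m.+2%:R :> rat by rewrite ltr0n.
have NM : m.+2%:R <= (2 * alpha + 1)%N%:R :> rat by rewrite ler_nat.
have Mn' : (2 * alpha + 1)%N%:R <= #|V|%:R :> rat by rewrite ler_nat.
rewrite natrM; apply: (cycle_arith N0 NM n2 Mn' e0 large).
move: le; rewrite -(ler_nat rat).
rewrite !(natrM, natrD, natrB, natrX) //; nat_lia.
Qed.

Theorem theorem5p7 (V : finType) (G : sgraph V) (n alpha : nat)
    (hconn : connected G)
    (hn : #|V| = n)
    (halpha : indep_number G = alpha)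
    (hn2alpha : (2 * alpha <= n)%N)
    (halpha1 : (1 <= alpha)%N) :
  exists T : sgraph V,
    spanning_tree G T /\
    avg_dist T <
      if (alpha <= 6)%N then alpha%:R + 1
      else alpha%:R + 1 / 2 + 4 * (alpha%:R - 1) / alpha%:R ^+ 2.
Proof.
have n1 : (1 < #|V|)%N by nat_lia.
have alpha_max B : independent G B -> (#|B| <= alpha)%N.
  by rewrite -halpha; apply: independent_card.
have core D K : set_connected G D -> dominating G D -> D != set0 -> (#|D| <= K)%N ->
    exists2 T, spanning_tree G T & (4 * wiener T < (K + 3) * #|V| * (#|V| - 1))%N.
  move=> cD dD neD leK; have [T sT leW] := core_spanning_tree cD dD neD.
  exists T => //; apply: leq_trans (core_arith _ (max_card _) n1 leW) _.
    by rewrite card_gt0.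
  by rewrite !leq_mul2r leq_add2r leK !orbT.
have /card_gt0P[r _] : (0 < #|V|)%N by nat_lia.
have ne1 x : [set x] != set0 :> {set V} by apply/set0Pn; exists x; rewrite set11.
have [A [D [scAD dA neA leD]]] := scaffold_saturate hconn (ne1 r) (scaffold1 G r).
have [sAD cD iA _] := scAD; rewrite !cards1 in leD.
have leA := alpha_max _ iA.
have dD := dominating_super sAD dA.
have neD : D != set0.
  by case/set0Pn: neA => x xA; apply/set0Pn; exists x; apply: (subsetP sAD).
case: leqP => a7.
  have [|T sT lt] := core D (2 * alpha - 1)%N cD dD neD; first by nat_lia.
  exists T; split=> //; apply: (nat_avg_dist_lt n1 lt).
  have -> : (2 * alpha - 1 + 3 = 2 * alpha + 2)%N by nat_lia.
  by rewrite natrD natrM; lra.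
have e0 : 0 <= 4 * (alpha%:R - 1) / alpha%:R ^+ 2 :> rat.
  by rewrite !mulr_ge0 ?invr_ge0 ?exprn_ge0 ?subr_ge0 ?ler1n.
have half (T : sgraph V) : (4 * wiener T < (2 * alpha + 1) * #|V| * (#|V| - 1))%N ->
    avg_dist T < alpha%:R + 1 / 2 + 4 * (alpha%:R - 1) / alpha%:R ^+ 2.
  move=> lt; apply: (nat_avg_dist_lt n1 lt).
  by rewrite natrD natrM; lra.
have [/existsP[S /and4P[cS dS neS leS]]|none] := boolP [exists S : {set V},
    [&& set_connected G S, dominating G S, S != set0 & (#|S| <= 2 * alpha - 2)%N]].
  have [T sT lt] := core S (2 * alpha - 2)%N cS dS neS leS.
  exists T; split=> //; apply: half.
  by have <- : (2 * alpha - 2 + 3 = 2 * alpha + 1)%N by nat_lia.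
have no_small S : set_connected G S -> dominating G S -> S != set0 ->
    (2 * alpha <= #|S| + 1)%N.
  move=> cS dS neS; apply: contraR none => lt.
  by apply/existsP; exists S; rewrite cS dS neS; nat_lia.
have clawfree : claw_free G.
  move=> c a b d ca cb cd ab ad bd nab nad nbd.
  have sc := scaffold_claw ca cb cd nab nad nbd ab ad bd.
  have [|A' [D' [sc' dA' neA' leD']]] := scaffold_saturate hconn _ sc.
    by apply/set0Pn; exists a; rewrite !inE eqxx.
  have [sAD' cD' iA' _] := sc'.
  have neD' : D' != set0.
    by case/set0Pn: neA' => x xA; apply/set0Pn; exists x; apply: (subsetP sAD').
  have := no_small D' cD' (dominating_super sAD' dA') neD'.
  have cardA : #|[set a; b; d]| = 3.
    by rewrite -setUA !cardsU1 cards1 !inE (negbTE ab) (negbTE ad) (negbTE bd).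
  have := cardsU1 c [set a; b; d]; rewrite cardA => cU.
  have := alpha_max _ iA'; rewrite cU cardA in leD'.
  (* Growing from the claw gives [#|D'| <= 2 * #|A'| - 2 <= 2 * alpha - 2], which is too small. *)
  by move: leD'; case: (_ \notin _); nat_lia.
have := no_small D cD dD neD => ge.
(* From [2 * alpha - 1 <= #|D| <= 2 * #|A| - 1] and [#|A| <= alpha], equality holds throughout. *)
have cardA : #|A| = alpha by nat_lia.
have cardD : (#|D| + 1 = 2 * alpha)%N by nat_lia.
have a1 : (1 < alpha)%N by nat_lia.
have [[E cE LE]|[q [m [qm m1 L0 Lm am]]]] :=
    four_noncut_or_long_alt a1 no_small clawfree scAD dA cardA cardD.
  have [T sT leW] :=
    four_noncut_spanning_tree a1 no_small clawfree scAD dA cardA cardD cE LE.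
  exists T; split=> //; apply: half.
  have -> : (2 * alpha + 1 = 2 * alpha - 1 + 2)%N by nat_lia.
  apply: four_leaves_arith; [by nat_lia | by have := max_card D; nat_lia|].
  by have -> : (2 * alpha - 1 - 2 = 2 * alpha - 3)%N by nat_lia.
have [T sT [Mn mM leW]] :=
  alt_cycle_spanning_tree alpha_max a1 no_small clawfree scAD dA cardA cardD qm m1 L0 Lm.
exists T; split=> //; apply: cycle_avg_dist_lt leW => //.
by case: qm.
Qed.
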